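(* Let $\Phi,\Psi\in L^\infty_{M_n}$ be of bounded type. If $\Phi$ or $\Psi$ has a tensored-scalar singularity, then $$H_\Phi^*H_\Phi=H_\Psi^*H_\Psi\iff \Phi-U\Psi\in H^\infty_{M_n}\ \text{ for some unitary constant matrix }U\in M_n.$$
   Context: $M_n$ is the algebra of complex $n\times n$ matrices. $L^\infty_{M_n}$ is the space of bounded measurable $n\times n$ matrix functions on the unit circle $\mathbb T$, $H^\infty_{M_n}$ its subspace of functions with entries in $H^\infty$; $H^2_{\mathbb C^n}\subset L^2_{\mathbb C^n}$ is the $\mathbb C^n$-valued Hardy space. A matrix function is of bounded type if each entry equals a.e. on $\mathbb T$ a quotient of two $H^\infty$ functions. For $\Phi\in L^\infty_{M_n}$ the Hankel operator $H_\Phi:H^2_{\mathbb C^n}\to H^2_{\mathbb C^n}$ is $H_\Phi f=J_nP_n^\perp(\Phi f)$, where $P_n^\perp$ is the orthogonal projection of $L^2_{\mathbb C^n}$ onto $(H^2_{\mathbb C^n})^\perp$ and $(J_nf)(z)=\overline z f(\overline z)$. A bounded type $\Phi\in L^\infty_{M_n}$ has a tensored-scalar singularity if there is a nonconstant scalar inner function $\theta$ with $\ker H_\Phi\subseteq\theta H^2_{\mathbb C^n}$. *)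

(* Defs.v *)
From mathcomp Require Import all_boot all_order all_algebra.
From mathcomp Require Import complex.
From mathcomp Require Import all_classical all_reals all_analysis.

Set Implicit Arguments.
Unset Strict Implicit.
Unset Printing Implicit Defensive.

Import Order.TTheory GRing.Theory Num.Theory.
Import numFieldNormedType.Exports.

Local Open Scope classical_set_scope.
Local Open Scope ring_scope.
Local Open Scope complex_scope.

(* A function on the unit circle is represented by a function of the angle
   t in [-pi, pi], with z = e^{it}; only its a.e. class on [-pi, pi] matters.
   Complex conjugation of z is the reflection t |-> -t. *)

Lemma ltNpipi (R : realType) : - pi < pi :> R.
Proof. by rewrite gtrN// pi_gt0. Qed.

(* normalized arc length, in the angular coordinate *)
Definition arc (R : realType) : probability (measurableTypeR R) R :=
  uniform_prob (ltNpipi R).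

Section HardySpaces.
Variable R : realType.
Local Notation C := (R[i]).
Local Notation mu := (arc R).

Definition zvar (t : R) : C := cos t +i* sin t.

Definition cmeasurable (f : R -> C) : Prop :=
  measurable_fun [set: measurableTypeR R] (fun t => complex.Re (f t)) /\
  measurable_fun [set: measurableTypeR R] (fun t => complex.Im (f t)).

Definition cintegral (f : R -> C) : C :=
  (\int[mu]_t complex.Re (f t)) +i* (\int[mu]_t complex.Im (f t)).

Definition cnorm (p : \bar R) (f : R -> C) : \bar R :=
  Lnorm mu p (fun t => (Normc.normc (f t))%:E).

Definition Lp (p : \bar R) (f : R -> C) : Prop :=
  cmeasurable f /\ (cnorm p f < +oo)%E.

Definition fourier (f : R -> C) (k : int) : C :=
  cintegral (fun t => f t * zvar t ^ (- k)).

Definition Hp (p : \bar R) (f : R -> C) : Prop :=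
  Lp p f /\ forall k : int, k < 0 -> fourier f k = 0.

Definition inner_function (theta : R -> C) : Prop :=
  Hp +oo theta /\ {ae mu, forall t, `|theta t| = 1}.

Definition nonconstant (theta : R -> C) : Prop :=
  ~ exists c : C, {ae mu, forall t, theta t = c}.

Definition bounded_type (phi : R -> C) : Prop :=
  exists a b : R -> C, [/\ Hp +oo a, Hp +oo b,
    {ae mu, forall t, b t != 0} & {ae mu, forall t, phi t = a t / b t}].

Variable n : nat.
Local Notation vfun := (R -> 'cV[C]_n).
Local Notation mfun := (R -> 'M[C]_n).

Definition Linf_mx (Phi : mfun) : Prop :=
  forall i j, Lp +oo (fun t => Phi t i j).

Definition Hinf_mx (Phi : mfun) : Prop :=
  forall i j, Hp +oo (fun t => Phi t i j).

Definition bounded_type_mx (Phi : mfun) : Prop :=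
  forall i j, bounded_type (fun t => Phi t i j).

Definition L2_vec (f : vfun) : Prop := forall i, Lp 2%:E (fun t => f t i 0).

Definition H2_vec (f : vfun) : Prop := forall i, Hp 2%:E (fun t => f t i 0).

Definition inner (f g : vfun) : C :=
  cintegral (fun t => \sum_i f t i 0 * (g t i 0)^*).

Definition H2_perp (g : vfun) : Prop :=
  L2_vec g /\ forall h, H2_vec h -> inner g h = 0.

(* The operators below are only determined up to a.e. equality: each picks a
   representative of the class characterized by the given set. *)

Definition Pperp (f : vfun) : vfun :=
  xget (fun=> 0) [set g | H2_perp g /\ H2_vec (fun t => f t - g t)].

Definition Jop (f : vfun) : vfun := fun t => (zvar t)^* *: f (- t).

Definition hankel (Phi : mfun) (f : vfun) : vfun :=
  Jop (Pperp (fun t => Phi t *m f t)).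

(* adjoint of an operator A : H^2 -> H^2 *)
Definition adjoint (A : vfun -> vfun) (g : vfun) : vfun :=
  xget (fun=> 0)
    [set h | H2_vec h /\ forall f, H2_vec f -> inner (A f) g = inner f h].

Definition eq_op_H2 (A B : vfun -> vfun) : Prop :=
  forall f, H2_vec f -> {ae mu, forall t, A f t = B f t}.

Definition ker_hankel (Phi : mfun) (f : vfun) : Prop :=
  H2_vec f /\ {ae mu, forall t, hankel Phi f t = 0}.

Definition tensored_scalar_singularity (Phi : mfun) : Prop :=
  exists theta : R -> C, [/\ inner_function theta, nonconstant theta &
    forall f, ker_hankel Phi f ->
      exists2 g, H2_vec g & {ae mu, forall t, f t = theta t *: g t}].

End HardySpaces.

(* Main.v *)
Require Import Defs.
From mathcomp Require Import all_boot all_order all_algebra.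
From mathcomp Require Import complex.
From mathcomp Require Import all_classical all_reals all_analysis.
From mathcomp Require Import measurable_realfun.
From mathcomp Require Import ring lra.

Set Implicit Arguments.
Unset Strict Implicit.
Unset Printing Implicit Defensive.

Import Order.TTheory GRing.Theory Num.Theory.
Import numFieldNormedType.Exports.

Local Open Scope classical_set_scope.
Local Open Scope complex_scope.
Local Open Scope ring_scope.
(** Why the theorem holds.  The Hankel operator turns multiplication by z into
    the backward shift: on passing from f to z f, the function H_Phi f loses
    only its coefficient at z^0, which is c(f), the coefficient of Phi f at
    z^(-1).  Since the backward shift is an isometry apart from that
    coefficient,

      (H_Phi z f, H_Phi z g) = (H_Phi f, H_Phi g) - (c(f), c(g))

    (lemma [hankel_inner_shift]).  If the operators H^* H of Phi and Psi agree,
    both inner products on the right and on the left agree, so c_Phi and c_Psi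
    have the same Gram matrices on H^2.  For f = z^m e_j the vector c(f) is the
    j-th column of the Fourier coefficient of Phi at -1-m.  Hence the columns of
    all negative Fourier coefficients of Phi and of Psi are two families of
    vectors of C^n with equal Gram matrices, and a single unitary matrix carries
    one family to the other ([gram_family_unitary]): it is the U with
    Phi - U Psi analytic.

    Conversely, if Phi - U Psi is analytic then multiplication by it preserves
    H^2 ([Hpoo_mul_Hp2]), so that the parts of Phi f and U Psi f orthogonal to
    H^2 coincide, and U disappears from the inner products (H f, H g); these
    determine H^* H.

    The analysis behind this is the L^2 theory of the circle.  The projection
    onto H^2 and the adjoint exist because annihilators in L^2 admit orthogonal
    projections ([orth_projection], from the completeness of L^2).  That a
    bounded analytic function multiplies H^2 into itself rests on the uniqueness
    of Fourier coefficients ([fourier_uniqueness]): trigonometric polynomials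
    approximate the indicators of arcs boundedly, so a function with no nonzero
    Fourier coefficient has a vanishing primitive. *)

(** * Complex-valued integrals and square integrable functions *)

Section ComplexIntegral.
Context (R : realType).
Local Notation C := (R[i]).
Local Notation mu := (Defs.arc R).
Local Notation T := (measurableTypeR R).
Implicit Types (f g h : R -> C).

Lemma ReD (z w : C) : complex.Re (z + w) = complex.Re z + complex.Re w.
Proof. by case: z w => ? ? []. Qed.
Lemma ImD (z w : C) : complex.Im (z + w) = complex.Im z + complex.Im w.
Proof. by case: z w => ? ? []. Qed.
Lemma ReN (z : C) : complex.Re (- z) = - complex.Re z.
Proof. by case: z. Qed.
Lemma ImN (z : C) : complex.Im (- z) = - complex.Im z.
Proof. by case: z. Qed.
Lemma ReM (z w : C) :
  complex.Re (z * w) = complex.Re z * complex.Re w - complex.Im z * complex.Im w.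
Proof. by case: z w => ? ? []. Qed.
Lemma ImM (z w : C) :
  complex.Im (z * w) = complex.Re z * complex.Im w + complex.Im z * complex.Re w.
Proof. by case: z w => ? ? []. Qed.
Lemma ReJ (z : C) : complex.Re z^* = complex.Re z. Proof. by case: z. Qed.
Lemma ImJ (z : C) : complex.Im z^* = - complex.Im z. Proof. by case: z. Qed.
Definition ReImE := (ReD, ImD, ReN, ImN, ReM, ImM, ReJ, ImJ).

Lemma eq_ReIm (z w : C) :
  complex.Re z = complex.Re w -> complex.Im z = complex.Im w -> z = w.
Proof. by case: z w => ? ? [? ?] /= -> ->. Qed.

(** The squared modulus with values in R: the norm of R[i] lives in R[i]. *)
Definition sqn (z : C) : R := complex.Re z ^+ 2 + complex.Im z ^+ 2.

Lemma sqn_ge0 (z : C) : 0 <= sqn z.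
Proof. by rewrite addr_ge0 ?sqr_ge0. Qed.

Lemma sqnE (z : C) : (sqn z)%:C = z * z^*.
Proof. by rewrite add_Re2_Im2 sqr_normc. Qed.

Lemma sqnM (z w : C) : sqn (z * w) = sqn z * sqn w.
Proof. rewrite /sqn !ReImE; ring. Qed.

Lemma sqnJ (z : C) : sqn z^* = sqn z.
Proof. by rewrite /sqn !ReImE sqrrN. Qed.

Lemma sqn_eq0 (z : C) : sqn z = 0 -> z = 0.
Proof.
by move=> h; apply/eqP; rewrite -normr_eq0 -sqrf_eq0 -add_Re2_Im2 -/(sqn z) h.
Qed.

Lemma sqn_normc (z : C) : sqn z = Normc.normc z ^+ 2.
Proof. by case: z => a b /=; rewrite sqr_sqrtr ?sqn_ge0 // addr_ge0 ?sqr_ge0. Qed.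

(** ** Measurability *)

Lemma cmeasurable_cst (c : C) : cmeasurable (fun _ : R => c).
Proof. by split; exact: measurable_cst. Qed.

Lemma cmeasurableD f g : cmeasurable f -> cmeasurable g ->
  cmeasurable (fun t => f t + g t).
Proof.
move=> [f1 f2] [g1 g2]; split.
- by under eq_fun do rewrite ReD; exact: measurable_funD.
- by under eq_fun do rewrite ImD; exact: measurable_funD.
Qed.

Lemma cmeasurableM f g : cmeasurable f -> cmeasurable g ->
  cmeasurable (fun t => f t * g t).
Proof.
move=> [f1 f2] [g1 g2]; split.
- by under eq_fun do rewrite ReM; apply: measurable_funB; apply: measurable_funM.
- by under eq_fun do rewrite ImM; apply: measurable_funD; apply: measurable_funM.
Qed.

Lemma cmeasurableJ f : cmeasurable f -> cmeasurable (fun t => (f t)^*).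
Proof.
move=> [f1 f2]; split.
- by under eq_fun do rewrite ReJ.
- by under eq_fun do rewrite ImJ; exact: measurableT_comp.
Qed.

Lemma cmeasurableN f : cmeasurable f -> cmeasurable (fun t => - f t).
Proof.
move=> [f1 f2]; split.
- by under eq_fun do rewrite ReN; exact: measurableT_comp.
- by under eq_fun do rewrite ImN; exact: measurableT_comp.
Qed.

Lemma measurable_sqn f : cmeasurable f ->
  measurable_fun [set: T] (fun t => sqn (f t)).
Proof. by move=> [f1 f2]; apply: measurable_funD; apply: measurable_funX. Qed.

Lemma measurable_cosT : measurable_fun [set: T] (@cos R).
Proof. by apply: continuous_measurable_fun; exact: continuous_cos. Qed.
Lemma measurable_sinT : measurable_fun [set: T] (@sin R).
Proof. by apply: continuous_measurable_fun; exact: continuous_sin. Qed.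

Lemma cmeasurable_zvar : cmeasurable (@zvar R).
Proof. by split; [exact: measurable_cosT|exact: measurable_sinT]. Qed.

Lemma sqn_zvar (t : R) : sqn (zvar t) = 1.
Proof. exact: cos2Dsin2. Qed.

Lemma zvar_neq0 (t : R) : zvar t != 0.
Proof.
apply/eqP => h; have := sqn_zvar t; rewrite h /sqn /= expr0n addr0 => /esym/eqP.
by rewrite oner_eq0.
Qed.

Lemma zvarJ (t : R) : (zvar t)^* = (zvar t)^-1.
Proof.
apply: (mulfI (zvar_neq0 t)); rewrite divff ?zvar_neq0 //.
by rewrite -sqnE sqn_zvar.
Qed.

Lemma cmeasurableX f n : cmeasurable f -> cmeasurable (fun t => f t ^+ n).
Proof.
move=> mf; elim: n => [|n IH]; first exact: cmeasurable_cst.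
by under eq_fun do rewrite exprS; exact: cmeasurableM.
Qed.

Lemma cmeasurable_zvarz (k : int) : cmeasurable (fun t : R => zvar t ^ k).
Proof.
case: k => n; first exact: cmeasurableX cmeasurable_zvar.
under eq_fun do rewrite NegzE -exprnN -exprVn -zvarJ.
exact/cmeasurableX/cmeasurableJ/cmeasurable_zvar.
Qed.

Lemma zvarzJ (k : int) (t : R) : (zvar t ^ k)^* = zvar t ^ (- k).
Proof.
by rewrite -[in RHS]exprz_inv -zvarJ /exprz; case: k => n;
  rewrite ?fmorphV /= rmorphXn.
Qed.

Lemma sqn_zvarz (k : int) (t : R) : sqn (zvar t ^ k) = 1.
Proof.
apply: (@complexI R).
by rewrite sqnE zvarzJ -expfzDr ?zvar_neq0 // subrr expr0z.
Qed.

(** ** Integration *)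

Lemma ae_filter_arc : Filter (almost_everywhere mu).
Proof. exact: (@ae_filter_ringOfSetsType _ T R mu). Qed.

Lemma aeW (P : R -> Prop) : (forall t, P t) -> {ae mu, forall t, P t}.
Proof. by move=> h; apply: (@nearW _ _ _ ae_filter_arc). Qed.

Lemma aeS (P Q : R -> Prop) : (forall t, P t -> Q t) ->
  {ae mu, forall t, P t} -> {ae mu, forall t, Q t}.
Proof. by move=> PQ; exact: (@filterS _ _ ae_filter_arc). Qed.

Lemma aeS2 (P Q S : R -> Prop) : (forall t, P t -> Q t -> S t) ->
  {ae mu, forall t, P t} -> {ae mu, forall t, Q t} -> {ae mu, forall t, S t}.
Proof. by move=> PQ; exact: (@filterS2 _ _ ae_filter_arc). Qed.


Definition cL1 f := mu.-integrable setT (EFin \o (fun t => complex.Re (f t))) /\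
  mu.-integrable setT (EFin \o (fun t => complex.Im (f t))).

Lemma integrable_le (u v : R -> R) : measurable_fun [set: T] u ->
  (forall t, `|u t| <= v t) ->
  mu.-integrable setT (EFin \o v) -> mu.-integrable setT (EFin \o u).
Proof.
move=> mu_ uv; apply: le_integrable => //; first exact/measurable_EFinP.
by move=> t _ /=; rewrite lee_fin; apply: (le_trans (uv t)); exact: ler_norm.
Qed.

Lemma integrable_measurable (u : R -> R) :
  mu.-integrable setT (EFin \o u) -> measurable_fun [set: T] u.
Proof. by move=> /integrableP[/measurable_EFinP]. Qed.

Lemma cL1_cmeasurable f : cL1 f -> cmeasurable f.
Proof. by move=> [a b]; split; exact: integrable_measurable. Qed.

Lemma integrableDr (u v : R -> R) : mu.-integrable setT (EFin \o u) ->
  mu.-integrable setT (EFin \o v) ->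
  mu.-integrable setT (EFin \o (fun t => u t + v t)).
Proof. by move=> iu iv; exact: (integrableD _ iu iv). Qed.

Lemma integrableZlr (k : R) (u : R -> R) : mu.-integrable setT (EFin \o u) ->
  mu.-integrable setT (EFin \o (fun t => k * u t)).
Proof. by move=> iu; exact: (integrableZl _ k iu). Qed.

Lemma integrableBr (u v : R -> R) : mu.-integrable setT (EFin \o u) ->
  mu.-integrable setT (EFin \o v) ->
  mu.-integrable setT (EFin \o (fun t => u t - v t)).
Proof. by move=> iu iv; exact: (integrableB _ iu iv). Qed.

Lemma cL1D f g : cL1 f -> cL1 g -> cL1 (fun t => f t + g t).
Proof.
move=> [f1 f2] [g1 g2]; split.
- by under eq_fun do rewrite ReD; exact: integrableDr.
- by under eq_fun do rewrite ImD; exact: integrableDr.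
Qed.

Lemma cL1Z c f : cL1 f -> cL1 (fun t => c * f t).
Proof.
move=> [f1 f2]; split.
- by under eq_fun do rewrite ReM; apply: integrableBr; exact: integrableZlr.
- by under eq_fun do rewrite ImM; apply: integrableDr; exact: integrableZlr.
Qed.

Lemma cL1_0 : cL1 (fun=> 0).
Proof. by split; exact: integrable0. Qed.

Lemma cL1_sum (I : Type) (s : seq I) (F : I -> R -> C) :
  (forall i, cL1 (F i)) -> cL1 (fun t => \sum_(i <- s) F i t).
Proof.
move=> h; elim: s => [|i s IH].
  by under eq_fun do rewrite big_nil; exact: cL1_0.
by under eq_fun do rewrite big_cons; exact: cL1D.
Qed.

Lemma cintegralD f g : cL1 f -> cL1 g ->
  cintegral (fun t => f t + g t) = cintegral f + cintegral g.
Proof.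
move=> [f1 f2] [g1 g2]; apply: eq_ReIm; rewrite ?ReImE /=.
- by under eq_Rintegral do rewrite ReD; rewrite RintegralD.
- by under eq_Rintegral do rewrite ImD; rewrite RintegralD.
Qed.

Lemma cintegralZ c f : cL1 f -> cintegral (fun t => c * f t) = c * cintegral f.
Proof.
move=> [f1 f2]; apply: eq_ReIm; rewrite ?ReImE /=.
- under eq_Rintegral do rewrite ReM.
  by rewrite RintegralB ?RintegralZl //; exact: integrableZlr.
- under eq_Rintegral do rewrite ImM.
  by rewrite RintegralD ?RintegralZl //; exact: integrableZlr.
Qed.

Lemma cintegralJ f : cL1 f -> cintegral (fun t => (f t)^*) = (cintegral f)^*.
Proof.
move=> [f1 f2]; apply: eq_ReIm; rewrite ?ReImE /=.
- by under eq_Rintegral do rewrite ReJ.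
- by under eq_Rintegral do rewrite ImJ -mulN1r; rewrite RintegralZl // mulN1r.
Qed.

Lemma cintegral0 : cintegral (fun _ : R => 0 : C) = 0.
Proof. by apply: eq_ReIm => /=; rewrite Rintegral_cst // mul0r. Qed.

Lemma cintegral_sum (I : Type) (s : seq I) (F : I -> R -> C) :
  (forall i, cL1 (F i)) ->
  cintegral (fun t => \sum_(i <- s) F i t) = \sum_(i <- s) cintegral (F i).
Proof.
move=> h; elim: s => [|i s IH].
  by under eq_fun do rewrite big_nil; rewrite big_nil cintegral0.
under eq_fun do rewrite big_cons.
by rewrite cintegralD ?IH ?big_cons //; exact: cL1_sum.
Qed.

Lemma Rintegral_arc_cst (c : R) : \int[mu]_t c = c.
Proof.
have e : mu [set: T] = 1%E := probability_setT mu.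
transitivity (c * fine (mu [set: T])); first exact: Rintegral_cst.
by rewrite e mulr1.
Qed.

Lemma ae_eq_Rintegral (u v : R -> R) : measurable_fun [set: T] u ->
  measurable_fun [set: T] v -> {ae mu, forall t, u t = v t} ->
  \int[mu]_t u t = \int[mu]_t v t.
Proof.
move=> mu_ mv uv; congr fine; apply: ae_eq_integral => //.
- exact/measurable_EFinP.
- exact/measurable_EFinP.
- by apply: aeS uv => t /= ->.
Qed.

Lemma ae_eq_cintegral f g : cmeasurable f -> cmeasurable g ->
  {ae mu, forall t, f t = g t} -> cintegral f = cintegral g.
Proof.
move=> [f1 f2] [g1 g2] fg; apply: eq_ReIm => /=; apply: ae_eq_Rintegral => //;
  by apply: aeS fg => t ->.
Qed.

(** ** The space L^2 *)

Local Notation L2 := (@Lp R 2%:E).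

(** Square integrability stated through [sqn], where the integrand is a
    polynomial in the real and imaginary parts and the L^2 norm involves no
    root. *)
Lemma Lp2P f : L2 f <->
  cmeasurable f /\ mu.-integrable setT (EFin \o (fun t => sqn (f t))).
Proof.
have E : (\int[mu]_t `|(sqn (f t))%:E| =
  \int[mu]_t (`|(Normc.normc (f t))%:E| `^ 2))%E.
  apply: eq_integral => t _ /=; rewrite powR_mulrn //.
  by rewrite real_normK ?num_real // sqn_normc ger0_norm ?sqr_ge0.
split=> -[mf].
  rewrite /cnorm unlock => h; split => //; apply/integrableP; split.
    by apply/measurable_EFinP; exact: measurable_sqn.
  rewrite /= E ltey; apply: contraTneq h => ->.
  by rewrite poweRyr ?invr_neq0 ?pnatr_eq0 // ltxx.
move=> /integrableP[_ h]; split => //; rewrite /cnorm unlock.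
by apply: poweR_lty; rewrite -E.
Qed.

Lemma Lp2_cmeasurable f : L2 f -> cmeasurable f.
Proof. by case. Qed.

Lemma Lp2_sqn f : L2 f -> mu.-integrable setT (EFin \o (fun t => sqn (f t))).
Proof. by move=> /Lp2P[]. Qed.

Lemma Lp2D f g : L2 f -> L2 g -> L2 (fun t => f t + g t).
Proof.
move=> /Lp2P[mf f2] /Lp2P[mg g2]; apply/Lp2P; split; first exact: cmeasurableD.
apply: (@integrable_le _ (fun t => 2 * sqn (f t) + 2 * sqn (g t))).
- by apply: measurable_sqn; exact: cmeasurableD.
- move=> t; rewrite ger0_norm ?sqn_ge0 // /sqn !ReImE.
  rewrite -subr_ge0.
  have := sqr_ge0 (complex.Re (f t) - complex.Re (g t)).
  have := sqr_ge0 (complex.Im (f t) - complex.Im (g t)); lra.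
- by apply: integrableDr; exact: integrableZlr.
Qed.

Lemma Lp2_cst c : L2 (fun=> c).
Proof.
apply/Lp2P; split; first exact: cmeasurable_cst.
by apply: finite_measure_integrable_cst.
Qed.

Lemma Lp2J f : L2 f -> L2 (fun t => (f t)^*).
Proof.
move=> /Lp2P[mf f2]; apply/Lp2P; split; first exact: cmeasurableJ.
by under eq_fun do rewrite sqnJ.
Qed.

(** Multiplication by an essentially bounded function preserves L^2; the
    bound is on the squared modulus, which is polynomial in the parts. *)
Lemma Lp2_bounded_mul (M : R) f g : cmeasurable g ->
  {ae mu, forall t, sqn (g t) <= M} -> L2 f -> L2 (fun t => g t * f t).
Proof.
move=> mg bg /Lp2P[mf f2]; apply/Lp2P; split; first exact: cmeasurableM.
have mgf : measurable_fun [set: T] (fun t => sqn (g t * f t)).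
  by apply: measurable_sqn; exact: cmeasurableM.
apply/integrableP; split; first exact/measurable_EFinP.
have : mu.-integrable setT (EFin \o (fun t => M * sqn (f t))).
  exact: integrableZlr.
move=> /integrableP[mMf]; apply: le_lt_trans.
apply: ae_ge0_le_integral => //.
- by apply: measurableT_comp => //; exact/measurable_EFinP.
- exact: measurableT_comp.
- apply: aeS bg => t bt _ /=; rewrite lee_fin sqnM.
  rewrite ger0_norm ?mulr_ge0 ?sqn_ge0 //; apply: le_trans (ler_norm _).
  by rewrite ler_wpM2r ?sqn_ge0.
Qed.

Lemma Lp2Z c f : L2 f -> L2 (fun t => c * f t).
Proof.
apply: (@Lp2_bounded_mul (sqn c)); first exact: cmeasurable_cst.
by apply: aeW.
Qed.

Lemma Lp2N f : L2 f -> L2 (fun t => - f t).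
Proof. by move=> /(Lp2Z (-1)); under eq_fun do rewrite mulN1r. Qed.

Lemma Lp2B f g : L2 f -> L2 g -> L2 (fun t => f t - g t).
Proof. by move=> lf /Lp2N; exact: Lp2D. Qed.

Lemma Lp2_zvarz_mul (k : int) f : L2 f -> L2 (fun t => zvar t ^ k * f t).
Proof.
apply: (@Lp2_bounded_mul 1); first exact: cmeasurable_zvarz.
by apply: aeW => t; rewrite sqn_zvarz.
Qed.

Lemma Lp2_zvarz (k : int) : L2 (fun t => zvar t ^ k).
Proof.
by have := Lp2_zvarz_mul k (Lp2_cst 1); under eq_fun do rewrite mulr1.
Qed.

Lemma Lp2_sum (I : Type) (s : seq I) (F : I -> R -> C) :
  (forall i, L2 (F i)) -> L2 (fun t => \sum_(i <- s) F i t).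
Proof.
move=> h; elim: s => [|i s IH].
  by under eq_fun do rewrite big_nil; exact: Lp2_cst.
by under eq_fun do rewrite big_cons; exact: Lp2D.
Qed.

Lemma cL1_mul f g : L2 f -> L2 g -> cL1 (fun t => f t * g t).
Proof.
move=> /Lp2P[mf f2] /Lp2P[mg g2].
have [m1 m2] := cmeasurableM mf mg.
by split; apply: (@integrable_le _ (fun t => sqn (f t) + sqn (g t)));
 rewrite //; try exact: integrableDr; move=> t; rewrite ?ReM ?ImM /sqn ler_norml;
 apply/andP; split; rewrite -subr_ge0;
 have := sqr_ge0 (complex.Re (f t) - complex.Re (g t));
 have := sqr_ge0 (complex.Re (f t) + complex.Re (g t));
 have := sqr_ge0 (complex.Im (f t) - complex.Im (g t));
 have := sqr_ge0 (complex.Im (f t) + complex.Im (g t));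
 have := sqr_ge0 (complex.Re (f t) - complex.Im (g t));
 have := sqr_ge0 (complex.Re (f t) + complex.Im (g t));
 have := sqr_ge0 (complex.Im (f t) - complex.Re (g t));
 have := sqr_ge0 (complex.Im (f t) + complex.Re (g t));
 have := sqr_ge0 (complex.Im (f t)); have := sqr_ge0 (complex.Re (f t));
 have := sqr_ge0 (complex.Im (g t)); have := sqr_ge0 (complex.Re (g t)); nra.
Qed.

(** ** The scalar inner product *)

Definition dot f g : C := cintegral (fun t => f t * (g t)^*).

Lemma cL1_dot f g : L2 f -> L2 g -> cL1 (fun t => f t * (g t)^*).
Proof. by move=> lf /Lp2J; exact: cL1_mul. Qed.

Lemma dotDl f g h : L2 f -> L2 g -> L2 h ->
  dot (fun t => f t + g t) h = dot f h + dot g h.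
Proof.
move=> lf lg lh; rewrite /dot -cintegralD; [|exact: cL1_dot..].
by congr cintegral; apply/funext => t; rewrite mulrDl.
Qed.

Lemma dotZl c f h : L2 f -> L2 h -> dot (fun t => c * f t) h = c * dot f h.
Proof.
move=> lf lh; rewrite /dot -cintegralZ; last exact: cL1_dot.
by congr cintegral; apply/funext => t; rewrite mulrA.
Qed.

Lemma dotC f g : L2 f -> L2 g -> dot g f = (dot f g)^*.
Proof.
move=> lf lg; rewrite /dot -cintegralJ; last exact: cL1_dot.
congr cintegral; apply/funext => t.
by rewrite rmorphM /= conjCK mulrC.
Qed.

Lemma dotNl f h : L2 f -> L2 h -> dot (fun t => - f t) h = - dot f h.
Proof.
move=> lf lh; rewrite -[RHS]mulN1r -dotZl //.
have -> // : (fun t => - f t) = (fun t => -1 * f t).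
by apply/funext => t; rewrite mulN1r.
Qed.

Lemma dotBl f g h : L2 f -> L2 g -> L2 h ->
  dot (fun t => f t - g t) h = dot f h - dot g h.
Proof. by move=> lf lg lh; rewrite dotDl ?dotNl //; exact: Lp2N. Qed.

Lemma dotDr f g h : L2 f -> L2 g -> L2 h ->
  dot h (fun t => f t + g t) = dot h f + dot h g.
Proof.
move=> lf lg lh; rewrite (dotC lf lh) (dotC lg lh) (dotC (Lp2D lf lg) lh).
by rewrite dotDl // rmorphD.
Qed.

Lemma dotZr c f h : L2 f -> L2 h -> dot h (fun t => c * f t) = c^* * dot h f.
Proof.
move=> lf lh; rewrite (dotC lf lh) (dotC (Lp2Z c lf) lh).
by rewrite dotZl // rmorphM.
Qed.

Lemma dotBr f g h : L2 f -> L2 g -> L2 h ->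
  dot h (fun t => f t - g t) = dot h f - dot h g.
Proof.
move=> lf lg lh; rewrite (dotC lf lh) (dotC lg lh) (dotC (Lp2B lf lg) lh).
by rewrite dotBl // rmorphB.
Qed.

Lemma ae_eq_dot f f' g g' : cmeasurable f -> cmeasurable f' -> cmeasurable g ->
  cmeasurable g' -> {ae mu, forall t, f t = f' t} ->
  {ae mu, forall t, g t = g' t} -> dot f g = dot f' g'.
Proof.
move=> mf mf' mg mg' ff' gg'; apply: ae_eq_cintegral.
- by apply/cmeasurableM => //; exact: cmeasurableJ.
- by apply/cmeasurableM => //; exact: cmeasurableJ.
- by apply: aeS2 ff' gg' => t -> ->.
Qed.

Definition normsq f : R := \int[mu]_t sqn (f t).

Lemma dot_normsq f : dot f f = (normsq f)%:C.
Proof.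
apply: eq_ReIm => /=.
- by apply: eq_Rintegral => t _; rewrite -sqnE.
- transitivity (\int[mu]_t (0 : R)); last by rewrite Rintegral_cst // mul0r.
  by apply: eq_Rintegral => t _; rewrite -sqnE.
Qed.

Lemma normsq_ge0 f : 0 <= normsq f.
Proof. by apply: Rintegral_ge0 => t _; exact: sqn_ge0. Qed.

Lemma normsqZ c f : L2 f -> normsq (fun t => c * f t) = sqn c * normsq f.
Proof.
move=> lf; rewrite /normsq -RintegralZl //; last exact: Lp2_sqn.
by apply: eq_Rintegral => t _; rewrite sqnM.
Qed.

Lemma normsqD f g : L2 f -> L2 g ->
  normsq (fun t => f t + g t) = normsq f + normsq g + 2 * complex.Re (dot f g).
Proof.
move=> lf lg; apply: (@complexI R); rewrite -dot_normsq.
rewrite dotDl ?dotDr //; last exact: Lp2D.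
rewrite !dot_normsq (dotC lf lg); apply: eq_ReIm; rewrite !ReImE /=; ring.
Qed.

Lemma normsq_eq0 f : L2 f -> normsq f = 0 -> {ae mu, forall t, f t = 0}.
Proof.
move=> /Lp2P[mf f2] h.
have : (\int[mu]_t `|(sqn (f t))%:E| = 0)%E.
  under eq_integral do rewrite gee0_abs ?lee_fin ?sqn_ge0 //.
  have := integrable_fin_num measurableT f2 => /fineK <-.
  by rewrite -[fine _]/(normsq f) h.
move=> /ae_eq_integral_abs H.
have {}H := H measurableT (proj2 (measurable_EFinP _ _) (measurable_sqn mf)).
by apply: aeS H => t /(_ I) [] /sqn_eq0.
Qed.

End ComplexIntegral.
(** * Families of vectors with equal Gram matrices *)

Section Gram.
Context (C : numClosedFieldType).
Local Open Scope sesquilinear_scope.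

Lemma mulmx_adj_eq0 m n (Z : 'M[C]_(m, n)) : Z *m Z ^t* = 0 -> Z = 0.
Proof.
move=> h; apply/matrixP => i j; rewrite mxE.
have := congr1 (fun A : 'M[C]_m => A i i) h.
rewrite !mxE; under eq_bigr do rewrite !mxE -normCK.
move=> /eqP; rewrite psumr_eq0 => [/allP /(_ j)|k _]; last by rewrite exprn_ge0.
by rewrite mem_index_enum => /(_ isT) /=; rewrite sqrf_eq0 normr_eq0 => /eqP.
Qed.

Lemma adj_mulmx m n p (A : 'M[C]_(m, n)) (B : 'M[C]_(n, p)) :
  (A *m B) ^t* = B ^t* *m A ^t*.
Proof. by rewrite trmx_mul map_mxM. Qed.

Lemma unitarymx_sqr m n (V : 'M[C]_(m, n)) : m = n -> V \is unitarymx ->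
  V ^t* *m V = 1%:M.
Proof. by move=> mn; case: n / mn V => V /unitarymxP /mulmx1C. Qed.

Lemma unitarymx_complete m n (S : 'M[C]_(m, n)) : S \is unitarymx ->
  exists k (N : 'M[C]_(k, n)), (m + k)%N = n /\ col_mx S N \is unitarymx.
Proof.
move=> uS; pose K := row_base (kermx (S ^t*)).
have rS : \rank (S ^t*) = m by rewrite mxrank_map mxrank_tr mxrank_unitary.
have rK : (m + \rank (kermx (S ^t*)))%N = n.
  by rewrite mxrank_ker rS subnKC // -rS rank_leq_row.
exists (\rank (kermx (S ^t*))), (schmidt K); split => //.
have NS : schmidt K *m S ^t* = 0.
  by apply/sub_kermxP; rewrite (eqmx_schmidt_free (row_base_free _)) eq_row_base.
have SN : S *m (schmidt K) ^t* = 0.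
  by have := congr1 (fun Z => Z ^t*) NS; rewrite adj_mulmx trmxCK trmx0 map_mx0.
apply/unitarymxP; rewrite tr_col_mx map_row_mx mul_col_row SN NS.
rewrite (unitarymxP uS) (unitarymxP (schmidt_unitarymx K (rank_leq_col _))).
by rewrite -scalar_mx_block.
Qed.

Lemma unitarymx_transport m n (S T : 'M[C]_(m, n)) : S \is unitarymx ->
  T \is unitarymx -> exists2 U : 'M[C]_n, U \is unitarymx & S = T *m U.
Proof.
move=> /[dup] uS /unitarymx_complete[k [N [kn uN]]].
move=> /[dup] uT /unitarymx_complete[k' [N' [kn' uN']]].
have kk : k' = k by apply/eqP; rewrite -(eqn_add2l m) kn kn'.
case: k / kk N kn uN => N kn uN.
have TN : T *m N' ^t* = 0.
  move/unitarymxP: uN'; rewrite tr_col_mx map_row_mx mul_col_row.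
  by rewrite scalar_mx_block => /eq_block_mx[].
exists ((col_mx T N') ^t* *m col_mx S N).
  apply/unitarymxP; rewrite adj_mulmx trmxCK mulmxA -(mulmxA _ (col_mx S N)).
  by rewrite (unitarymxP uN) mulmx1 unitarymx_sqr.
rewrite mulmxA tr_col_mx map_row_mx mul_mx_row (unitarymxP uT) TN.
by rewrite mul_row_col mul1mx mul0mx addr0.
Qed.

(** Equality of the Gram matrices means that X and Y satisfy the same linear
    relations; so the coefficients that write the rows of X in an orthonormal
    basis of their span do the same for Y. *)
Lemma gram_unitarymx m n (X Y : 'M[C]_(m, n)) : X *m X ^t* = Y *m Y ^t* ->
  exists2 U : 'M[C]_n, U \is unitarymx & X = Y *m U.
Proof.
move=> XY.
have same p (M : 'M[C]_(p, m)) : M *m X = 0 -> M *m Y = 0.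
  move=> MX; apply: mulmx_adj_eq0; rewrite adj_mulmx mulmxA -(mulmxA M).
  by rewrite -XY mulmxA MX !mul0mx.
pose B := row_base X; pose S := schmidt B.
have SX : (S :=: X)%MS.
  exact: eqmx_trans (eqmx_schmidt_free (row_base_free X)) (eq_row_base X).
pose L := S *m pinvmx X; have LX : S = L *m X by rewrite mulmxKpV ?SX.
pose A := X *m pinvmx S; have AS : X = A *m S by rewrite mulmxKpV ?SX.
have uS : S \is unitarymx by rewrite schmidt_unitarymx // rank_leq_col.
have uT : L *m Y \is unitarymx.
  apply/unitarymxP; rewrite adj_mulmx mulmxA -(mulmxA L) -XY mulmxA -LX.
  by rewrite -mulmxA -adj_mulmx -LX; exact/unitarymxP.
have AT : Y = A *m (L *m Y).
  apply/eqP; rewrite -subr_eq0 mulmxA -{1}[Y]mul1mx -mulmxBl; apply/eqP/same.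
  by rewrite mulmxBl mul1mx -mulmxA -LX -AS subrr.
have [U uU SU] := unitarymx_transport uS uT.
by exists U => //; rewrite {1}AS SU {2}AT mulmxA.
Qed.

(** Infinite families reduce to finite ones: a finite subfamily of maximal rank
    already spans all the vectors. *)
Lemma gram_family_unitary (I : Type) n (a b : I -> 'rV[C]_n) :
  (forall i j, a i *m (a j) ^t* = b i *m (b j) ^t*) ->
  exists2 U : 'M[C]_n, U \is unitarymx & forall i, a i = b i *m U.
Proof.
move=> ab.
pose sub (c : I -> 'rV[C]_n) k (f : 'I_k -> I) := \matrix_(i < k) c (f i).
have gram k (f : 'I_k -> I) : sub a k f *m (sub a k f) ^t* =
    sub b k f *m (sub b k f) ^t*.
  apply/matrixP => i j; have /matrixP/(_ 0 0) := ab (f i) (f j).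
  rewrite !mxE; under eq_bigr do rewrite !mxE.
  move=> h; under eq_bigr do rewrite !mxE; rewrite h.
  by apply: eq_bigr => l _; rewrite !mxE.
pose P r := `[< exists k (f : 'I_k -> I), \rank (sub a k f) = r >].
have P0 : exists r, P r.
  have f0 : 'I_0 -> I by case.
  by exists 0%N; apply/asboolP; exists 0%N, f0; apply/eqP; rewrite -leqn0 rank_leq_row.
have Pn r : P r -> (r <= n)%N.
  by move=> /asboolP[k [f <-]]; exact: rank_leq_col.
case: (ex_maxnP P0 Pn) => r /asboolP[k [f fr]] maxr.
have [U uU XU] := gram_unitarymx (gram k f).
exists U => // i.
pose g (j : 'I_(k + 1)) := match fintype.split j with inl j => f j | inr _ => i end.
have gE (c : I -> 'rV[C]_n) : sub c (k + 1)%N g = col_mx (sub c k f) (c i).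
  apply/matrixP => j l; rewrite !mxE /g; case: (fintype.split j) => j' //=.
    by rewrite mxE.
  by rewrite ord1.
have [V uV] := gram_unitarymx (gram _ g); rewrite !gE mul_col_mx.
move=> /eq_col_mx[XV aV].
have ai : (a i <= sub a k f)%MS.
  have le : (sub a k f <= col_mx (sub a k f) (a i))%MS.
    by rewrite -addsmxE addsmxSl.
  apply: (@submx_trans _ _ _ _ _ _ (col_mx (sub a k f) (a i))).
    by rewrite -addsmxE addsmxSr.
  rewrite -(mxrank_leqif_sup le) eqn_leq mxrankS //= fr -gE.
  by apply: maxr; apply/asboolP; exists (k + 1)%N, g.
have [u au] := submxP ai.
have bu : b i = u *m sub b k f.
  have Vu := unitarymx_unit uV.
  apply: (can_inj (mulmxK Vu)); rewrite -mulmxA -XV -au; exact/esym.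
by rewrite bu -mulmxA -XU.
Qed.

End Gram.
(** * Completeness of L^2 and orthogonal projections *)

Section Completeness.
Context (R : realType).
Local Notation C := (R[i]).
Local Notation mu := (Defs.arc R).
Local Notation T := (measurableTypeR R).
Local Notation L2 := (@Lp R 2%:E).

(** Fast convergence in quadratic mean makes the telescoping series of the
    sequence absolutely convergent in L^1, hence almost everywhere. *)
Lemma fast_cauchy_ae_cvg (u : nat -> R -> R) :
  (forall k, measurable_fun [set: T] (u k)) ->
  (forall k, mu.-integrable setT (EFin \o (fun t => (u k.+1 t - u k t) ^+ 2))) ->
  (forall k, \int[mu]_t (u k.+1 t - u k t) ^+ 2 <= ((2 ^ k.+1)%:R^-1) ^+ 2) ->
  exists2 v : R -> R, measurable_fun [set: T] v &
    {ae mu, forall t, u ^~ t @ \oo --> v t}.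
Proof.
move=> mu_ iu ub.
pose h k : R := (2 ^ k.+1)%:R^-1.
have h0 k : 0 < h k by rewrite invr_gt0 ltr0n expn_gt0.
pose d k t : R := `|u k.+1 t - u k t|.
have md k : measurable_fun [set: T] (d k).
  by apply: measurableT_comp => //; exact: measurable_funB.
(* 2 d <= d^2 / h + h, with h the size expected of d *)
have dle k t : d k t <= 2^-1 * ((h k)^-1 * (u k.+1 t - u k t) ^+ 2) + 2^-1 * h k.
  rewrite -subr_ge0 -[(u _ _ - _) ^+ 2]real_normK ?num_real // -/(d k t).
  rewrite (_ : _ - _ = 2^-1 * (h k)^-1 * (d k t - h k) ^+ 2).
    by rewrite mulr_ge0 ?sqr_ge0 // mulr_ge0 ?invr_ge0 // ltW.
  by field; rewrite gt_eqF.
have idk k : mu.-integrable setT (EFin \o d k).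
  apply: (@integrable_le _ _ (fun t => 2^-1 * ((h k)^-1 *
     (u k.+1 t - u k t) ^+ 2) + 2^-1 * h k)) => //.
    by move=> t; rewrite normr_id; exact: dle.
  apply: integrableDr; first by apply: integrableZlr; exact: integrableZlr.
  by apply: finite_measure_integrable_cst.
have intd k : (\int[mu]_t (d k t)%:E <= (1 / (2 ^ k.+1)%:R)%:E)%E.
  rewrite div1r -/(h k) -(fineK (integrable_fin_num measurableT (idk k))) lee_fin.
  apply: (@le_trans _ _ (\int[mu]_t (2^-1 * ((h k)^-1 *
     (u k.+1 t - u k t) ^+ 2) + 2^-1 * h k))).
    apply: le_Rintegral => //.
    apply: integrableDr; first by apply: integrableZlr; exact: integrableZlr.
    by apply: finite_measure_integrable_cst.
  rewrite RintegralD //; first last.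
  - by apply: finite_measure_integrable_cst.
  - by apply: integrableZlr; exact: integrableZlr.
  rewrite Rintegral_arc_cst.
  rewrite RintegralZl //; last exact: integrableZlr.
  rewrite RintegralZl //.
  have := ub k; rewrite -/(h k) => le.
  have : (h k)^-1 * \int[mu]_t (u k.+1 t - u k t) ^+ 2 <= h k.
    by rewrite mulrC ler_pdivrMr // -expr2.
  lra.
have ds0 : forall (k : nat) (t : T), [set: T] t -> (0 <= (d k t)%:E)%E.
  by move=> k t _; rewrite lee_fin /d normr_ge0.
have mde k : measurable_fun [set: T] (fun t => (d k t)%:E).
  exact/measurable_EFinP.
have sumfin : mu.-integrable setT (fun t => \sum_(k <oo) (d k t)%:E)%E.
  apply/integrableP; split.
    by apply: ge0_emeasurable_sum => // k t _ _; exact: ds0.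
  under eq_integral.
    move=> t _; rewrite gee0_abs; last by apply: nneseries_ge0 => k _ _; exact: ds0.
    over.
  rewrite integral_nneseries //.
  apply: (@le_lt_trans _ _ 1%:E); last by rewrite ltry.
  apply: le_trans (epsilon_trick0 xpredT (@ler01 R)).
  apply: lee_nneseries => [k _ _|k _]; last exact: intd.
  by apply: integral_ge0 => t Dt; exact: ds0.
have cv : {ae mu, forall t, cvgn (u ^~ t)}.
  apply: aeS (integrable_ae measurableT sumfin) => t /(_ I) fint.
  have : cvgn (series (fun k => d k t)).
    apply: nondecreasing_is_cvgn.
      by apply: nondecreasing_series => *; rewrite /d normr_ge0.
    exists (fine (\sum_(k <oo) (d k t)%:E)%E) => _ [k _ <-].
    rewrite -lee_fin fineK // seriesEnat /= -sumEFin.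
    by apply: nneseries_lim_ge => i _ _; exact: ds0.
  move=> cd; have : cvgn (series (telescope (u ^~ t))) by apply: normed_cvg.
  rewrite telescopeK => /cvg_ex[l ul]; apply/cvg_ex; exists (l + u 0%N t).
  have -> : u ^~ t = (fun k => (u k t - u 0%N t) + u 0%N t).
    by apply/funext => k; rewrite subrK.
  by apply: cvgD => //; exact: cvg_cst.
exists (fun t => fine (limn_esup (fun k => (u k t)%:E))).
  apply: measurableT_comp; first exact: fine_measurable.
  by apply: measurable_fun_limn_esup => k; exact/measurable_EFinP.
apply: aeS cv => t /cvg_ex[l ul].
have -> : limn_esup (fun k => (u k t)%:E) = l%:E.
  have cE : (fun k => (u k t)%:E) @ \oo --> l%:E.
    by apply: cvg_EFin => //; exact: nearW.
  by rewrite (cvg_limn_einf_sup cE).2.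
exact: ul.
Qed.

(** Convergence of both parts, which spares a topology on R[i]. *)
Definition ccvg (f_ : nat -> R -> C) (f : R -> C) (t : R) : Prop :=
  ((fun k => complex.Re (f_ k t)) @ \oo --> complex.Re (f t)) /\
  ((fun k => complex.Im (f_ k t)) @ \oo --> complex.Im (f t)).

(** Fatou's lemma: the limit need not be known to be square integrable in
    advance, and no uniform domination is required. *)
Lemma fatou_normsq (f_ : nat -> R -> C) (f : R -> C) (M : R) :
  (forall k, L2 (f_ k)) -> (forall k, normsq (f_ k) <= M) -> cmeasurable f ->
  {ae mu, forall t, ccvg f_ f t} -> L2 f /\ normsq f <= M.
Proof.
move=> lf fM mf cf.
have ms k : measurable_fun [set: T] (fun t => (sqn (f_ k t))%:E).
  by apply/measurable_EFinP; apply: measurable_sqn; exact: Lp2_cmeasurable.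
have mi : measurable_fun [set: T] (fun t => limn_einf (fun k => (sqn (f_ k t))%:E)).
  under eq_fun do rewrite -[limn_einf _]oppeK -limn_esupN.
  apply: measurableT_comp => //; apply: measurable_fun_limn_esup => k.
  exact: measurableT_comp.
have mff : measurable_fun [set: T] (fun t => (sqn (f t))%:E).
  by apply/measurable_EFinP; exact: measurable_sqn.
have le : (\int[mu]_t (sqn (f t))%:E <= M%:E)%E.
  apply: (@le_trans _ _ (\int[mu]_t limn_einf (fun k => (sqn (f_ k t))%:E))%E).
    apply: ae_ge0_le_integral => //.
    - by move=> t _; rewrite lee_fin sqn_ge0.
    - move=> t _; rewrite limn_einf_lim; apply: lime_ge; first exact: is_cvg_einfs.
      apply: nearW => k; apply: le_ereal_inf_tmp => _ [j _ <-].
      by rewrite lee_fin sqn_ge0.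
    - apply: aeS cf => t [c1 c2] _.
      have [-> //] : (limn_einf (fun k => (sqn (f_ k t))%:E) = (sqn (f t))%:E) *
        (limn_esup (fun k => (sqn (f_ k t))%:E) = (sqn (f t))%:E).
      apply: cvg_limn_einf_sup; apply: cvg_EFin; first exact: nearW.
      by rewrite /sqn; apply: cvgD; under eq_fun do rewrite expr2; rewrite expr2;
        exact: cvgM.
  apply: le_trans (fatou mu measurableT ms _) _.
    by move=> k t _; rewrite lee_fin sqn_ge0.
  rewrite limn_einf_lim; apply: lime_le; first exact: is_cvg_einfs.
  apply: nearW => k; apply: (@le_trans _ _ (\int[mu]_t (sqn (f_ k t))%:E)%E).
    by apply: ereal_inf_lbound; exists k => /=.
  rewrite -(fineK (integrable_fin_num measurableT (Lp2_sqn (lf k)))) lee_fin.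
  exact: fM.
have i2 : mu.-integrable setT (EFin \o (fun t => sqn (f t))).
  apply/integrableP; split => //; apply: le_lt_trans (ltry M).
  under eq_integral do rewrite /= ger0_norm ?sqn_ge0 //; exact: le.
split; first by apply/Lp2P.
by rewrite -lee_fin /normsq /Rintegral fineK // integrable_fin_num.
Qed.

Lemma fast_cauchy_L2 (f_ : nat -> R -> C) : (forall k, L2 (f_ k)) ->
  (forall k, normsq (fun t => f_ k.+1 t - f_ k t) <= ((2 ^ k.+1)%:R^-1) ^+ 2) ->
  exists2 f, cmeasurable f & {ae mu, forall t, ccvg f_ f t}.
Proof.
move=> lf fc.
have part (p : C -> R) : (forall z w, p (z - w) = p z - p w) ->
    (forall z, p z ^+ 2 <= sqn z) ->
    (forall f, cmeasurable f -> measurable_fun [set: T] (fun t => p (f t))) ->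
    exists2 v : R -> R, measurable_fun [set: T] v &
    {ae mu, forall t, (fun k => p (f_ k t)) @ \oo --> (v t : R)}.
  move=> pB ple mp.
  have ip k : mu.-integrable setT
      (EFin \o (fun t => (p (f_ k.+1 t) - p (f_ k t)) ^+ 2)).
    have ld := Lp2B (lf k.+1) (lf k).
    apply: integrable_le (Lp2_sqn ld).
      under eq_fun do rewrite -pB; apply: measurable_funX.
      exact: (mp _ (Lp2_cmeasurable ld)).
    by move=> t; rewrite -pB ger0_norm ?sqr_ge0.
  apply: fast_cauchy_ae_cvg => //.
    by move=> k; exact: mp (Lp2_cmeasurable (lf k)).
  move=> k; apply: le_trans (fc k); apply: le_Rintegral => //.
    exact: Lp2_sqn (Lp2B (lf k.+1) (lf k)).
  by move=> t _; rewrite -pB.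
have [||a b|v1 mv1 c1] := part (@complex.Re R).
- by move=> z w; rewrite !ReImE.
- by move=> z; rewrite lerDl sqr_ge0.
- by case: b.
have [||a b|v2 mv2 c2] := part (@complex.Im R).
- by move=> z w; rewrite !ReImE.
- by move=> z; rewrite lerDr sqr_ge0.
- by case: b.
exists (fun t => v1 t +i* v2 t); first by split.
by apply: aeS2 c1 c2 => t ? ?; split.
Qed.

End Completeness.
Section Projection.
Context (R : realType).
Local Notation C := (R[i]).
Local Notation mu := (Defs.arc R).
Local Notation L2 := (@Lp R 2%:E).
Implicit Types (f g h a : R -> C) (A : set (R -> C)).

Definition orth A : set (R -> C) :=
  [set g | L2 g /\ forall a, A a -> dot g a = 0].

Lemma orthD A g h : A `<=` L2 -> orth A g -> orth A h -> orth A (fun t => g t + h t).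
Proof.
move=> lA [lg og] [lh oh]; split=> [|a Aa]; first exact: Lp2D.
by rewrite dotDl ?og ?oh ?addr0 //; exact: lA.
Qed.

Lemma orthZ A c g : A `<=` L2 -> orth A g -> orth A (fun t => c * g t).
Proof.
move=> lA [lg og]; split=> [|a Aa]; first exact: Lp2Z.
by rewrite dotZl ?og ?mulr0 //; exact: lA.
Qed.

Lemma two_pow_inv_small (e : R) : 0 < e -> exists k, (2 ^ k.+1)%:R^-1 < e.
Proof.
move=> e0; exists (Num.bound e^-1); rewrite invf_plt ?posrE ?ltr0n ?expn_gt0 //.
apply: (@lt_trans _ _ (Num.bound e^-1)%:R).
  by rewrite archi_boundP // invr_ge0 ltW.
by rewrite ltr_nat (ltn_trans (ltnSn _)) // ltn_expl.
Qed.

Lemma sqn_real (c : R) : sqn c%:C = c ^+ 2.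
Proof. by rewrite /sqn /= expr0n addr0. Qed.

Lemma Re_dotZr (c : R) g a : L2 g -> L2 a ->
  complex.Re (dot g (fun t => c%:C * a t)) = c * complex.Re (dot g a).
Proof. by move=> lg la; rewrite dotZr // ReM ReJ ImJ /= oppr0 mul0r subr0. Qed.

Lemma Re_dotZi g a : L2 g -> L2 a ->
  complex.Re (dot g (fun t => 'i * a t)) = complex.Im (dot g a).
Proof.
move=> lg la; rewrite dotZr // ReM ReJ ImJ -complexiE /=.
by rewrite mul0r mulN1r opprK add0r.
Qed.

(** A weak form of the Cauchy-Schwarz inequality, from the positivity of
    [normsq (g + c a)] at c = s and c = - s; it avoids square roots. *)
Lemma Re_dot_le g a (s : R) : L2 g -> L2 a -> 0 < s -> normsq g <= s ^+ 2 ->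
  `|complex.Re (dot g a)| <= s * (1 + normsq a).
Proof.
move=> lg la s0 gs.
have P (c : R) : 0 <= normsq g + c ^+ 2 * normsq a + 2 * c * complex.Re (dot g a).
  apply: le_trans (normsq_ge0 (fun t => g t + c%:C * a t)) _.
  rewrite normsqD ?normsqZ //; last exact: Lp2Z.
  rewrite Re_dotZr // sqn_real; lra.
rewrite ler_norml; apply/andP; split; rewrite -(ler_pM2l s0); [have := P s|have := P (- s)];
  have := normsq_ge0 a; nra.
Qed.

(** Orthogonality to a passes to limits: the witnesses x are the errors of
    approximations of g that are already orthogonal to a. *)
Lemma dot_eq0_approx g a : L2 g -> L2 a ->
  (forall k, exists2 x, dot g a = dot x a & L2 x /\
     normsq x <= ((2 ^ k.+1)%:R^-1) ^+ 2) ->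
  dot g a = 0.
Proof.
move=> lg la ex.
have small (r M : R) : 0 < M ->
    (forall k, `|r| <= (2 ^ k.+1)%:R^-1 * M) -> r = 0.
  move=> M0 rM; apply/eqP; rewrite -normr_le0 leNgt; apply/negP => r0.
  have [k hk] := two_pow_inv_small (divr_gt0 r0 M0).
  by have := rM k; rewrite leNgt -ltr_pdivlMr // hk.
have h0 k : 0 < (2 ^ k.+1)%:R^-1 :> R by rewrite invr_gt0 ltr0n expn_gt0.
have M0 (b : R -> C) : 0 < 1 + normsq b by rewrite ltr_pwDl ?normsq_ge0.
apply: eq_ReIm; rewrite -[RHS]/(0 : R).
  apply: (small _ _ (M0 a)) => k; have [x -> [lx xk]] := ex k.
  exact: Re_dot_le.
have -> : complex.Im (dot g a) = complex.Re (dot g (fun t => 'i * a t)).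
  by rewrite Re_dotZi.
apply: (small _ _ (M0 (fun t => 'i * a t))) => k; have [x xE [lx xk]] := ex k.
by rewrite dotZr // xE -dotZr //; apply: Re_dot_le => //; exact: Lp2Z.
Qed.

Lemma parallelogram f g : L2 f -> L2 g ->
  normsq (fun t => f t - g t) + normsq (fun t => f t + g t) =
  2 * (normsq f + normsq g).
Proof.
move=> lf lg; rewrite (normsqD lf (Lp2N lg)) (normsqD lf lg).
have -> : normsq (fun t => - g t) = normsq g.
  by apply: eq_Rintegral => t _; rewrite /sqn !ReImE !sqrrN.
have -> : dot f (fun t => - g t) = - dot f g.
  by rewrite (dotC (Lp2N lg) lf) (dotC lg lf) dotNl // rmorphN.
by rewrite ReN; lra.
Qed.

(** The nearest point of a closed subspace.  Annihilators [orth A] are the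
    closed subspaces that are needed, and their closedness is
    [dot_eq0_approx]. *)
Lemma orth_projection A f : A `<=` L2 -> L2 f ->
  exists2 g, orth A g & forall h, orth A h -> dot (fun t => f t - g t) h = 0.
Proof.
move=> lA lf.
pose E := [set normsq (fun t => f t - g t) | g in orth A].
have hE : has_inf E.
  split; last by exists 0 => _ [g _ <-]; exact: normsq_ge0.
  exists (normsq (fun t => f t - 0)), (fun=> 0) => //; split; first exact: Lp2_cst.
  move=> a Aa; rewrite /dot; under eq_fun do rewrite mul0r.
  exact: cintegral0.
pose h k : R := (2 ^ k.+1)%:R^-1.
have h0 k : 0 < h k by rewrite invr_gt0 ltr0n expn_gt0.
have hle k j : h (k + j)%N <= h k.
  by rewrite lef_pV2 ?posrE ?ltr0n ?expn_gt0 // ler_nat leq_exp2l // ltnS leq_addr.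
have hle2 k j : h (k + j)%N ^+ 2 <= h k ^+ 2.
  by rewrite lerXn2r ?hle // nnegrE ltW ?h0.
have /choice[g_ g_P] : forall k, exists g, orth A g /\
    normsq (fun t => f t - g t) < inf E + h k ^+ 2 / 4.
  move=> k.
  have e0 : 0 < h k ^+ 2 / 4 by rewrite divr_gt0 // exprn_gt0.
  by have [_ [g og <-] gl] := inf_adherent e0 hE; exists g.
have lg k : L2 (g_ k) by case: (g_P k) => -[].
have lfg k : L2 (fun t => f t - g_ k t) by exact: Lp2B.
have infE g : orth A g -> inf E <= normsq (fun t => f t - g t).
  by move=> og; apply: ge_inf; [case: hE|exists g].
have cauchy k j : normsq (fun t => g_ (k + j)%N t - g_ k t) <= h k ^+ 2.
  have := parallelogram (lfg k) (lfg (k + j)%N).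
  have -> : (fun t => f t - g_ k t - (f t - g_ (k + j)%N t)) =
      (fun t => g_ (k + j)%N t - g_ k t) by apply/funext => t; ring.
  have -> : (fun t => f t - g_ k t + (f t - g_ (k + j)%N t)) =
      (fun t => 2 * (f t - 2^-1 * (g_ k t + g_ (k + j)%N t))).
    by apply/funext => t; field.
  (* the midpoint lies in the subspace, so its distance to f is at least inf E *)
  have om : orth A (fun t => 2^-1 * (g_ k t + g_ (k + j)%N t)).
    by apply: orthZ => //; apply: orthD => //; [case: (g_P k)|case: (g_P (k + j)%N)].
  rewrite normsqZ; last by apply: Lp2B => //; case: om.
  have := infE _ om; case: (g_P k) => _; case: (g_P (k + j)%N) => _.
  have := hle2 k j.
  have -> : sqn (2 : C) = 4 by rewrite /sqn /= addr0 expr0n addr0; ring.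
  lra.
have fc k : normsq (fun t => g_ k.+1 t - g_ k t) <= h k ^+ 2.
  by have := cauchy k 1%N; rewrite addn1.
have [g mg cg] := fast_cauchy_L2 lg fc.
have shift k : {ae mu, forall t, ccvg (fun j => g_ (k + j)%N) g t}.
  apply: aeS cg => t [c1 c2]; split.
    by have := c1; rewrite -(cvg_shiftn k) /=; under eq_fun do rewrite addnC.
  by have := c2; rewrite -(cvg_shiftn k) /=; under eq_fun do rewrite addnC.
have ccvgB u v (w : R -> C) t : ccvg u v t ->
    ccvg (fun j s => w s - u j s) (fun s => w s - v s) t.
  move=> [c1 c2]; split; rewrite !ReImE; under eq_fun do rewrite !ReImE.
    by apply: cvgB => //; exact: cvg_cst.
  by apply: cvgB => //; exact: cvg_cst.
have fat k : L2 (fun t => f t - g t) /\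
    normsq (fun t => f t - g t) <= inf E + h k ^+ 2 / 4.
  apply: (@fatou_normsq _ (fun j t => f t - g_ (k + j)%N t)).
  - by move=> j; exact: lfg.
  - move=> j; case: (g_P (k + j)%N) => _ /ltW /le_trans; apply.
    by rewrite lerD2l ler_pM2r ?hle2 // invr_gt0.
  - by apply: cmeasurableD; [exact: Lp2_cmeasurable|exact: cmeasurableN].
  - by apply: aeS (shift k) => t; exact: ccvgB.
have Lfg : L2 (fun t => f t - g t) by case: (fat 0%N).
have Lg : L2 g.
  have -> : g = (fun t => f t - (f t - g t)) by apply/funext => t; ring.
  exact: Lp2B.
have near k : normsq (fun t => g_ k t - g t) <= h k ^+ 2.
  have [] // := @fatou_normsq _ (fun j t => g_ k t - g_ (k + j)%N t)
    (fun t => g_ k t - g t) (h k ^+ 2).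
  - by move=> j; exact: Lp2B.
  - move=> j; rewrite (le_trans _ (cauchy k j)) //.
    have -> : (fun t => g_ k t - g_ (k + j)%N t) =
        (fun t => -1 * (g_ (k + j)%N t - g_ k t)).
      by apply/funext => t; ring.
    rewrite normsqZ; last exact: Lp2B.
    by rewrite /sqn /= oppr0 expr0n addr0 sqrrN expr1n mul1r.
  - by apply: Lp2_cmeasurable; exact: Lp2B.
  - by apply: aeS (shift k) => t; exact: ccvgB.
have og : orth A g.
  split => // a Aa; have la := lA _ Aa.
  apply: dot_eq0_approx => // k; exists (fun t => -1 * (g_ k t - g t)).
    rewrite dotZl ?dotBl //; last exact: Lp2B.
    by case: (g_P k) => -[_ ->] // _; rewrite sub0r mulN1r opprK.
  split; first by apply: Lp2Z; exact: Lp2B.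
  rewrite normsqZ; last exact: Lp2B.
  by rewrite /sqn /= oppr0 expr0n addr0 sqrrN expr1n mul1r; exact: near.
exists g => // b ob.
have inf_le : normsq (fun t => f t - g t) <= inf E.
  rewrite leNgt; apply/negP => lt.
  have e0 : 0 < normsq (fun t => f t - g t) - inf E by rewrite subr_gt0.
  have [k hk] := two_pow_inv_small e0; have [_] := fat k.
  have : h k <= 1 by rewrite invf_le1 ?ltr0n ?expn_gt0 // ler1n expn_gt0.
  have := h0 k; rewrite -/(h k) in hk; nra.
have quad c : orth A c -> complex.Re (dot (fun t => f t - g t) c) = 0.
  move=> oc; have lc : L2 c by case: oc.
  set r := complex.Re _; set N := normsq c.
  have P (s : R) : 0 <= 2 * s * r + s ^+ 2 * N.
    have := infE _ (orthD lA og (orthZ (- s)%:C lA oc)).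
    have -> : (fun t => f t - (g t + (- s)%:C * c t)) =
        (fun t => (f t - g t) + s%:C * c t).
      by apply/funext => t; rewrite rmorphN; ring.
    rewrite normsqD ?normsqZ //; last exact: Lp2Z.
    rewrite Re_dotZr // sqn_real -/N -/r; lra.
  have N0 : 0 < 1 + N by rewrite ltr_pwDl ?normsq_ge0.
  apply/eqP; rewrite -sqrf_eq0 eq_le sqr_ge0 andbT.
  (* the quadratic is negative at this point unless r = 0 *)
have := P (- (r / (1 + N))).
  have -> : 2 * - (r / (1 + N)) * r + (- (r / (1 + N))) ^+ 2 * N =
      - (r ^+ 2 * ((2 + N) / (1 + N) ^+ 2)) by field; rewrite gt_eqF.
  rewrite oppr_ge0 pmulr_lle0 // divr_gt0 ?exprn_gt0 //; lra.
apply: eq_ReIm; first exact: quad.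
by rewrite -Re_dotZi //; [apply: quad; exact: orthZ|case: ob].
Qed.

End Projection.
(** * Uniqueness of Fourier coefficients *)

Section ArcLebesgue.
Context (R : realType).
Local Notation mu := (Defs.arc R).
Local Notation leb := (@lebesgue_measure R).
Local Notation T := (measurableTypeR R).
Local Notation D := `[- pi, pi : R]%classic.

Lemma ge0_integral_arc (u : R -> \bar R) : measurable_fun [set: T] u ->
  (forall t, 0 <= u t)%E ->
  (\int[mu]_t u t = (pi - - pi)^-1%:E * \int[leb]_(t in D) u t)%E.
Proof. exact: integral_uniform. Qed.

Lemma arc_const_gt0 : 0 < (pi - - pi)^-1 :> R.
Proof. by rewrite invr_gt0 subr_gt0 ltNpipi. Qed.

Lemma integrable_arc_lebesgue (u : R -> R) :
  mu.-integrable setT (EFin \o u) -> leb.-integrable D (EFin \o u).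
Proof.
move=> /integrableP[mu_ h]; apply/integrableP; split.
  exact: measurable_funTS.
move: h; rewrite ge0_integral_arc //; last exact: measurableT_comp.
have c0 := arc_const_gt0; rewrite !ltey; apply: contra => /eqP ->.
by rewrite gt0_muley ?lte_fin.
Qed.

Lemma integral_arc (u : R -> R) : mu.-integrable setT (EFin \o u) ->
  (\int[mu]_t (u t)%:E = (pi - - pi)^-1%:E * \int[leb]_(t in D) (u t)%:E)%E.
Proof.
move=> iu; have il := integrable_arc_lebesgue iu.
have mu_ : measurable_fun [set: T] (EFin \o u) by case/integrableP: iu.
rewrite integralE [in RHS]integralE !ge0_integral_arc //; last 2 first.
- exact: measurable_funeneg.
- exact: measurable_funepos.
rewrite [RHS]muleBr //; exact: integrable_add_def.
Qed.

(** Almost everywhere statements for arc length only see the open interval; the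
    end points are one point of the circle. *)
Lemma ae_arc_lebesgue (P : R -> Prop) :
  {ae leb, forall t, - pi < t < pi -> P t} -> {ae mu, forall t, P t}.
Proof.
move=> [N [mN N0 PN]].
pose I : set T := `]- pi, pi[%classic.
have mI : measurable I by exact: measurable_itv.
have out : mu (~` I) = 0%E.
  have <- : (\int[mu]_t (\1_(~` I) t)%:E = mu (~` I))%E.
    by rewrite integral_indic ?setIT //; exact: measurableC.
  rewrite ge0_integral_arc //; last first.
    by apply/measurable_EFinP; apply: measurable_indic; exact: measurableC.
  rewrite integral_indic //; last exact: measurableC.
  have -> : ~` I `&` `[- pi, pi]%classic = [set - pi] `|` [set pi].
    apply/seteqP; split=> t /=; rewrite !in_itv /=.
      move=> [/negP]; rewrite negb_and -!leNgt => /orP[h|h] /andP[h1 h2].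
        by left; apply/eqP; rewrite eq_le h.
      by right; apply/eqP; rewrite eq_le h2.
    have := ltNpipi R => /[dup] /ltW lep ltp.
    by move=> [->|->]; split; rewrite /I /= ?in_itv /= ?ltxx ?andbF ?lexx ?lep.
  set m := (X in (_ * X)%E); suff -> : m = 0%E by rewrite mule0.
  apply: countable_lebesgue_measure0; apply: finite_set_countable.
  exact: finite_set2.
have NM : mu N = 0%E.
  by move/null_content_dominatesP: (dominates_uniform_prob (ltNpipi R)); apply.
exists (N `|` ~` I); split.
- by apply: measurableU => //; exact: measurableC.
- by rewrite (@measureU0 _ _ _ mu) //; exact: measurableC.
- move=> t /= nP; case: (boolP (- pi < t < pi)) => h.
    by left; apply: PN => /= H; apply: nP; exact: H.
  by right; rewrite /I /= in_itv /=; exact/negP.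
Qed.

End ArcLebesgue.

Section TrigPolynomials.
Context (R : realType).
Local Notation C := (R[i]).
Local Notation mu := (Defs.arc R).

(** Laurent polynomials in z, with a common denominator z^N so that closure
    under products needs no bookkeeping of degrees. *)
Definition trigpoly (p : R -> C) : Prop :=
  exists N (q : {poly C}), forall t, p t = zvar t ^- N * q.[zvar t].

Lemma trigpoly_cst (c : C) : trigpoly (fun=> c).
Proof. by exists 0%N, c%:P => t; rewrite expr0 invr1 mul1r hornerC. Qed.

Lemma trigpolyD p q : trigpoly p -> trigpoly q -> trigpoly (fun t => p t + q t).
Proof.
move=> [N [P pE]] [M [Q qE]]; exists (N + M)%N, ('X^M * P + 'X^N * Q) => t.
rewrite pE qE !hornerE exprD.
by field; rewrite !expf_neq0 ?zvar_neq0.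
Qed.

Lemma trigpolyM p q : trigpoly p -> trigpoly q -> trigpoly (fun t => p t * q t).
Proof.
move=> [N [P pE]] [M [Q qE]]; exists (N + M)%N, (P * Q) => t.
by rewrite pE qE hornerM exprD invfM mulrACA.
Qed.

Lemma trigpolyX p n : trigpoly p -> trigpoly (fun t => p t ^+ n).
Proof.
move=> tp; elim: n => [|n IH]; first exact: trigpoly_cst.
by under eq_fun do rewrite exprS; exact: trigpolyM.
Qed.

Lemma trigpoly_zvar : trigpoly (@zvar R).
Proof. by exists 0%N, 'X => t; rewrite expr0 invr1 mul1r hornerX. Qed.

Lemma trigpoly_zvarV : trigpoly (fun t => (zvar t)^-1).
Proof. by exists 1%N, 1 => t; rewrite expr1 hornerC mulr1. Qed.

Lemma zvarB (s t : R) : zvar (s - t) = zvar s * (zvar t)^-1.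
Proof.
rewrite -zvarJ; apply: eq_ReIm; rewrite !ReImE /= ?cosB ?sinB; ring.
Qed.

Lemma trigpoly_cosB (x : R) : trigpoly (fun t => (cos (t - x))%:C).
Proof.
have E t : (cos (t - x))%:C = 2^-1 * ((zvar x)^-1 * zvar t + zvar x * (zvar t)^-1).
  have -> : (cos (t - x))%:C = 2^-1 * (zvar (t - x) + (zvar (t - x))^-1).
    rewrite -zvarJ; apply: (mulfI (_ : (2 : C) != 0)); first by rewrite pnatr_eq0.
    rewrite mulVKf ?pnatr_eq0 //; apply: eq_ReIm; rewrite !ReImE /=; ring.
  by rewrite zvarB invfM invrK [zvar t * _]mulrC [_^-1 * zvar x]mulrC.
under eq_fun do rewrite E.
exact: (trigpolyM (trigpoly_cst _)
  (trigpolyD (trigpolyM (trigpoly_cst _) trigpoly_zvar)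
             (trigpolyM (trigpoly_cst _) trigpoly_zvarV))).
Qed.

Lemma cintegral_trigpoly_eq0 (f p : R -> C) : Lp 2%:E f ->
  (forall k, fourier f k = 0) -> trigpoly p -> cintegral (fun t => f t * p t) = 0.
Proof.
move=> lf f0 [N [q pE]].
have -> : (fun t => f t * p t) = (fun t => \sum_(i < size q)
    q`_i * (f t * zvar t ^ (- (N%:Z - i%:Z)))).
  apply/funext => t; rewrite pE horner_coef mulrA mulr_sumr.
  apply: eq_bigr => i _; rewrite opprB expfzDr ?zvar_neq0 //.
  by rewrite -exprnP -exprnN; ring.
have L1 (k : int) : cL1 (fun t => f t * zvar t ^ (- k)).
  by apply: cL1_mul => //; exact: Lp2_zvarz.
rewrite cintegral_sum => [|i]; last exact: cL1Z.
by apply: big1 => i _; rewrite cintegralZ // -/(fourier f _) f0 mulr0.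
Qed.

End TrigPolynomials.

Section Step.
Context (R : realType).

Lemma bernoulli_le (y : R) n : -1 <= y -> 1 + n%:R * y <= (1 + y) ^+ n.
Proof.
move=> y1; elim: n => [|n IH]; first by rewrite mul0r addr0.
rewrite exprS; apply: le_trans (_ : (1 + y) * (1 + n%:R * y) <= _); last first.
  by rewrite ler_wpM2l // -lerBlDl sub0r.
rewrite -natr1 -subr_ge0.
have -> : (1 + y) * (1 + n%:R * y) - (1 + (n%:R + 1) * y) = n%:R * y ^+ 2 by ring.
by rewrite mulr_ge0 ?sqr_ge0.
Qed.

(** These polynomials in w separate [0, 1/2) from (1/2, 1]: by Bernoulli's
    inequality they are at least 1 - (2w)^n and at most (2w)^(-n). *)
Definition step (w : R) (n : nat) : R := (1 - w ^+ n) ^+ (2 ^ n).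

Lemma step_ge0 w n : 0 <= w <= 1 -> 0 <= step w n.
Proof. by move=> /andP[w0 w1]; rewrite exprn_ge0 // subr_ge0 exprn_ile1. Qed.

Lemma step_le1 w n : 0 <= w <= 1 -> step w n <= 1.
Proof.
move=> /andP[w0 w1]; rewrite exprn_ile1 // ?subr_ge0 ?exprn_ile1 //.
by rewrite lerBlDr lerDl exprn_ge0.
Qed.

Lemma step_cvg1 w : 0 <= w -> w < 2^-1 -> step w @ \oo --> (1 : R).
Proof.
move=> w0 w2; have w1 : w <= 1 by lra.
have w01 : 0 <= w <= 1 by rewrite w0 w1.
apply: (@squeeze_cvgr _ _ _ _ (fun n => 1 - (2 * w) ^+ n) (fun=> 1)).
- near=> n; rewrite step_le1 // andbT /step.
  apply: le_trans (bernoulli_le _ _); last by rewrite lerN2 exprn_ile1.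
  by rewrite mulrN exprMn natrX.
- rewrite -[X in _ --> X]subr0; apply: cvgB; first exact: cvg_cst.
  by apply: cvg_expr; rewrite ger0_norm; lra.
- exact: cvg_cst.
Unshelve. all: by end_near.
Qed.

Lemma step_cvg0 w : w <= 1 -> 2^-1 < w -> step w @ \oo --> (0 : R).
Proof.
move=> w1 w2; have w0 : 0 < w by lra.
have w01 : 0 <= w <= 1 by rewrite ltW.
apply: (@squeeze_cvgr _ _ _ _ (fun=> 0) (fun n => ((2 * w)^-1) ^+ n)).
- near=> n; rewrite step_ge0 //=.
  have wn : 0 < (2 * w) ^+ n by rewrite exprn_gt0 // mulr_gt0.
  have w0n : 0 <= w ^+ n by rewrite exprn_ge0 // ltW.
  rewrite exprVn -[leRHS]mul1r ler_pdivlMr //.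
  apply: (@le_trans _ _ (step w n * (1 + w ^+ n) ^+ (2 ^ n))).
    rewrite ler_wpM2l ?step_ge0 //.
    apply: le_trans (bernoulli_le _ _); last by apply: le_trans w0n; rewrite lerN10.
    by rewrite exprMn natrX lerDr.
  rewrite /step -exprMn exprn_ile1 //.
    by apply: mulr_ge0; [rewrite subr_ge0 exprn_ile1 // ltW|exact: addr_ge0].
  have -> : (1 - w ^+ n) * (1 + w ^+ n) = 1 - w ^+ n ^+ 2 by ring.
  by rewrite lerBlDr lerDl sqr_ge0.
- exact: cvg_cst.
- apply: cvg_expr; rewrite ger0_norm ?invr_ge0; last lra.
  by rewrite invf_lt1; lra.
Unshelve. all: by end_near.
Qed.

End Step.

Section FourierUniqueness.
Context (R : realType).
Local Notation C := (R[i]).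
Local Notation mu := (Defs.arc R).
Local Notation leb := (@lebesgue_measure R).
Local Notation T := (measurableTypeR R).
Local Notation D := `[- pi, pi : R]%classic.

(** An affine function of cosine with values in [0, 1] and the value 1/2 at the
    end points -pi and x, the threshold of [step]. *)
Definition arc_weight (x t : R) : R :=
  2^-1 - (cos (t - (x - pi) / 2) - cos ((x + pi) / 2)) / 4.

Lemma arc_weight_itv x t : 0 <= arc_weight x t <= 1.
Proof.
have := cos_geN1 (t - (x - pi) / 2); have := cos_le1 (t - (x - pi) / 2).
have := cos_geN1 ((x + pi) / 2); have := cos_le1 ((x + pi) / 2).
rewrite /arc_weight => *; lra.
Qed.

(** The arc from -pi to x is where the cosine of the distance to its midpoint
    exceeds the cosine of its half length. *)
Lemma arc_weight_lt x t : - pi < t < x -> x < pi -> arc_weight x t < 2^-1.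
Proof.
move=> /andP[t1 t2] x1; rewrite /arc_weight.
suff : cos ((x + pi) / 2) < cos (t - (x - pi) / 2) by lra.
rewrite -(cos_norm (t - _)) ltr_cos ?in_itv /=.
- rewrite ltr_norml; lra.
- by rewrite normr_ge0 ler_norml; lra.
- lra.
Qed.

Lemma arc_weight_gt x t : x < t < pi -> - pi < x -> 2^-1 < arc_weight x t.
Proof.
move=> /andP[t1 t2] x1; rewrite /arc_weight.
suff : cos (t - (x - pi) / 2) < cos ((x + pi) / 2) by lra.
have [le|lt] := leP (t - (x - pi) / 2) pi.
  by rewrite ltr_cos ?in_itv /=; lra.
have -> : cos (t - (x - pi) / 2) = cos (2 * pi - (t - (x - pi) / 2)).
  by rewrite -cosN -cosD2pi; congr cos; ring.
by rewrite ltr_cos ?in_itv /=; lra.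
Qed.

Lemma trigpoly_step x n : trigpoly (fun t => (step (arc_weight x t) n)%:C).
Proof.
have E t : (step (arc_weight x t) n)%:C = (1 + -1 * ((2^-1 + cos ((x + pi) / 2) / 4)%:C
    + (- 4^-1)%:C * (cos (t - (x - pi) / 2))%:C) ^+ n) ^+ (2 ^ n).
  rewrite -rmorphM -rmorphD mulN1r -rmorphXn /= -(rmorph1 (real_complex R)).
  rewrite -rmorphN -rmorphD -rmorphXn; congr (_ %:C); congr ((1 - _ ^+ n) ^+ _).
  by rewrite /arc_weight; ring.
under eq_fun do rewrite E.
apply: (@trigpolyX _ (fun t => _)).
apply: (@trigpolyD _ (fun=> _) (fun t => _)); first exact: trigpoly_cst.
apply: (@trigpolyM _ (fun=> _) (fun t => _)); first exact: trigpoly_cst.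
apply: (@trigpolyX _ (fun t => _)).
apply: (@trigpolyD _ (fun=> _) (fun t => _)); first exact: trigpoly_cst.
by apply: (@trigpolyM _ (fun=> _) (fun t => _));
  [exact: trigpoly_cst|exact: trigpoly_cosB].
Qed.

Lemma measurable_step x n :
  measurable_fun [set: T] (fun t => step (arc_weight x t) n).
Proof.
apply: measurable_funX; apply: measurable_funB => //; apply: measurable_funX.
apply: measurable_funB => //; apply: measurable_funM => //.
apply: measurable_funB => //; apply: measurableT_comp; first exact: measurable_cosT.
exact: measurable_funB.
Qed.

Section Annihilator.
Variables (u : R -> R) (iu : mu.-integrable setT (EFin \o u)).
Hypothesis u0 : forall P : R -> R, trigpoly (fun t => (P t)%:C) ->
  \int[mu]_t (u t * P t) = 0.

Lemma trig_annihil_step x n :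
  (\int[leb]_(t in D) (u t * step (arc_weight x t) n)%:E = 0)%E.
Proof.
have iuP : mu.-integrable setT (EFin \o (fun t => u t * step (arc_weight x t) n)).
  apply: (@integrable_le _ _ (fun t => `|u t|)); last exact: integrable_norm.
    apply: measurable_funM; first exact: integrable_measurable.
    exact: measurable_step.
  move=> t; rewrite normrM ler_piMr //.
  by rewrite ger0_norm ?step_ge0 ?step_le1 ?arc_weight_itv.
have := integral_arc iuP.
rewrite -(fineK (integrable_fin_num measurableT iuP)).
rewrite -[fine _]/(\int[mu]_t (u t * step (arc_weight x t) n)) u0; last first.
  exact: trigpoly_step.
move=> /esym/eqP; rewrite mule_eq0 eqe gt_eqF ?arc_const_gt0 //=.
by move/eqP.
Qed.

(** The polynomials [step (arc_weight x t) n] converge boundedly to the indicator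
    of the arc from -pi to x, away from -pi, x and pi. *)
Lemma trig_annihil_itv x : - pi < x < pi ->
  (\int[leb]_(t in D) ((u \_ `]-oo, x]%classic) t)%:E = 0)%E.
Proof.
move=> /andP[x1 x2].
have il := integrable_arc_lebesgue iu.
have mu_ : measurable_fun [set: T] u by exact: integrable_measurable.
have mur : measurable_fun [set: T] (u \_ `]-oo, x]%classic).
  have mI : measurable (`]-oo, x]%classic : set T) := measurable_itv _.
  by apply/(measurable_restrictT u mI); exact: measurable_funTS.
have [] := @dominated_convergence _ T R leb D (measurable_itv _)
  (fun n t => (u t * step (arc_weight x t) n)%:E)
  (fun t => ((u \_ `]-oo, x]%classic) t)%:E) (fun t => `|u t|%:E).
- move=> n; apply/measurable_EFinP; apply: measurable_funTS.
  by apply: measurable_funM => //; exact: measurable_step.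
- by apply/measurable_EFinP; exact: measurable_funTS.
- exists ([set - pi] `|` [set x] `|` [set pi]); split.
  + by do !apply: measurableU => //; exact: measurable_set1.
  + apply: countable_lebesgue_measure0; apply: finite_set_countable.
    by rewrite !finite_setU; do !split; exact: finite_set1.
  + move=> t /=; apply: contra_notP => nt; rewrite in_itv /= => /andP[t1 t2].
    have tNpi : t != - pi by apply/eqP => h; apply: nt; left; left.
    have tx : t != x by apply/eqP => h; apply: nt; left; right.
    have tpi : t != pi by apply/eqP => h; apply: nt; right.
    apply: cvg_EFin; first exact: nearW.
    have [lt|gt|e] := ltgtP t x; last by rewrite e eqxx in tx.
    * rewrite patchE ifT; last by rewrite inE /= in_itv /= ltW.
      rewrite -[X in _ --> X]mulr1; apply: cvgM; first exact: cvg_cst.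
      apply: step_cvg1; first by case/andP: (arc_weight_itv x t).
      by apply: arc_weight_lt => //; rewrite lt_def tNpi t1.
    * rewrite patchE ifF; last by apply: memNset => /=; rewrite in_itv /= leNgt gt.
      rewrite -[X in _ --> X](mulr0 (u t)); apply: cvgM; first exact: cvg_cst.
      apply: step_cvg0; first by case/andP: (arc_weight_itv x t).
      by apply: arc_weight_gt => //; rewrite gt lt_def eq_sym tpi t2.
- exact: integrable_norm.
- apply: (nearW (F := almost_everywhere leb)) => t n _.
  rewrite /= lee_fin normrM ler_piMr //.
  by rewrite ger0_norm ?step_ge0 ?step_le1 ?arc_weight_itv.
move=> _ _; rewrite (_ : [sequence _]_n = fun=> 0%E).
  by move=> /cvg_lim <- //; rewrite lim_cst.
by apply/funext => n; exact: trig_annihil_step.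
Qed.

(** The primitive of u is constant on (-pi, pi), so u vanishes at its Lebesgue
    points. *)
Lemma trig_annihil_ae_eq0 : {ae mu, forall t, u t = 0}.
Proof.
have il := integrable_arc_lebesgue iu.
have mD : measurable (D : set T) := measurable_itv _.
have ilT : leb.-integrable setT (EFin \o (u \_ D)).
  have := (@integrable_mkcond _ T R leb D (EFin \o u) mD).1 il.
  by rewrite restrict_EFin.
have := @FTC1Ny R (u \_ D) _ (integrable_locally mD il).
case=> [y|N [mN N0 NP]]; first exact: integrableS ilT.
apply: ae_arc_lebesgue; exists N; split => // t /= nP; apply: NP => /= -[_ H].
apply: nP => tpi; have := H; rewrite patchE ifT; last first.
  by rewrite inE /= in_itv /=; case/andP: tpi => /ltW -> /ltW ->.
move=> <-; rewrite derive1E.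
rewrite (@near_eq_derive _ _ _ _ (cst 0)); first by rewrite -derive1E derive1_cst.
near=> x.
have xpi : - pi < x < pi by near: x; exact: near_in_itvoo.
have e : \int[leb]_(s in D) (u \_ `]-oo, x]%classic) s = 0.
  by rewrite /Rintegral trig_annihil_itv.
rewrite -[RHS]e [LHS]Rintegral_mkcond [RHS]Rintegral_mkcond.
by apply: eq_Rintegral => s _; rewrite !patchE; case: ifP => //; case: ifP.
Unshelve. all: by end_near.
Qed.

End Annihilator.

Lemma fourier_uniqueness (f : R -> C) : Lp 2%:E f ->
  (forall k, fourier f k = 0) -> {ae mu, forall t, f t = 0}.
Proof.
move=> lf f0.
have [iRe iIm] : cL1 f.
  by have := cL1_mul lf (Lp2_cst 1); under eq_fun do rewrite mulr1.
have h P : trigpoly (fun t => (P t)%:C) -> cintegral (fun t => f t * (P t)%:C) = 0.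
  exact: cintegral_trigpoly_eq0.
have Re0 := @trig_annihil_ae_eq0 _ iRe; have Im0 := @trig_annihil_ae_eq0 _ iIm.
apply: aeS2 (Re0 _) (Im0 _) => [t r i|P tP|P tP]; first exact: eq_ReIm.
- have [<- _] := h P tP; apply: eq_Rintegral => t _.
  by rewrite ReM /= mulr0 subr0.
- have [_ <-] := h P tP; apply: eq_Rintegral => t _.
  by rewrite ImM /= mulr0 add0r.
Qed.

End FourierUniqueness.
(** * Reflection of the circle and powers of z *)

Section Reflection.
Context (R : realType).
Local Notation C := (R[i]).
Local Notation mu := (Defs.arc R).
Local Notation leb := (@lebesgue_measure R).
Local Notation T := (measurableTypeR R).

Lemma measurable_oppT : measurable_fun [set: T] (-%R : R -> T).
Proof. exact: oppr_measurable. Qed.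

Lemma ge0_integral_arcN (u : R -> \bar R) : measurable_fun [set: T] u ->
  (forall t, 0 <= u t)%E -> (\int[mu]_t u (- t)%R = \int[mu]_t u t)%E.
Proof.
move=> mu_ u0; have muN : measurable_fun [set: T] (fun t : R => u (- t)).
  exact: measurableT_comp mu_ measurable_oppT.
rewrite !ge0_integral_arc //; congr (_ * _)%E; apply/esym.
have DE : `[- pi, pi]%classic = (-%R : R -> T) @^-1` `[- pi, pi]%classic.
  by rewrite opp_preimage_itvbndbnd /= opprK.
rewrite [in RHS]DE -ge0_integral_pushforward //=; last exact: measurable_funTS.
by apply: eq_measure_integral => //= A mA AS; exact/esym/lebesgue_measureN.
Qed.

Lemma Rintegral_arcN (u : R -> R) : measurable_fun [set: T] u ->
  \int[mu]_t u (- t) = \int[mu]_t u t.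
Proof.
move=> mu_; congr fine; rewrite integralE [in RHS]integralE.
have mE : measurable_fun [set: T] (fun t => (u t)%:E) by exact/measurable_EFinP.
congr (_ - _)%E; rewrite -[RHS]ge0_integral_arcN //.
- by apply: eq_integral => t _; rewrite !funeposE.
- exact: measurable_funepos.
- by apply: eq_integral => t _; rewrite !funenegE.
- exact: measurable_funeneg.
Qed.

Lemma cintegral_opp (f : R -> C) : cmeasurable f ->
  cintegral (fun t => f (- t)) = cintegral f.
Proof. by move=> [f1 f2]; apply: eq_ReIm => /=; exact: Rintegral_arcN. Qed.

Lemma zvar_expz (m : nat) (t : R) : zvar t ^ m%:Z = zvar (m%:R * t).
Proof.
rewrite -exprnP; elim: m => [|m IH].
  by rewrite expr0 mul0r /zvar cos0 sin0.
rewrite exprS IH -natr1 mulrDl mul1r; apply: eq_ReIm; rewrite !ReImE /= ?cosD ?sinD; ring.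
Qed.

Lemma sin_natr_pi (m : nat) : sin (m%:R * pi) = 0 :> R.
Proof.
elim: m => [|m IH]; first by rewrite mul0r sin0.
by rewrite -natr1 mulrDl mul1r sinDpi IH oppr0.
Qed.

Lemma Rintegral_cosM (m : nat) : (0 < m)%N -> \int[mu]_t cos (m%:R * t) = 0 :> R.
Proof.
move=> m0; have m0R : (m%:R : R) != 0 by rewrite pnatr_eq0 -lt0n.
have mc : measurable_fun [set: T] (fun t : R => cos (m%:R * t)).
  apply: measurableT_comp; first exact: measurable_cosT.
  exact: measurable_funM.
have ic : mu.-integrable setT (EFin \o (fun t => cos (m%:R * t))).
  apply: (@integrable_le _ _ (fun=> 1)) => // [t|]; first exact: cos_max.
  by apply: finite_measure_integrable_cst.
rewrite /Rintegral integral_arc //.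
have dF (x : R) : is_derive x 1 (fun t => m%:R^-1 * sin (m%:R * t)) (cos (m%:R * x)).
  apply: is_derive_eq; rewrite /GRing.scale /=; field; exact: m0R.
rewrite (@continuous_FTC2 R _ (fun t => m%:R^-1 * sin (m%:R * t))) ?ltNpipi //.
- by rewrite mulrN sinN sin_natr_pi oppr0 mulr0 sube0 mule0.
- apply: continuous_subspaceT => x; apply: continuous_comp.
    by apply: cvgM; [exact: cvg_cst|exact: cvg_id].
  exact: continuous_cos.
- have cF : continuous (fun t : R => m%:R^-1 * sin (m%:R * t)).
    move=> x; apply: differentiable_continuous.
    by apply/derivable1_diffP; case: (dF x).
  split; first by move=> x _; case: (dF x).
    exact/cvg_at_right_filter/cF.
  exact/cvg_at_left_filter/cF.
- by move=> x _; rewrite derive1E; case: (dF x) => _ ->.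
Qed.

Lemma Rintegral_odd (u : R -> R) : measurable_fun [set: T] u ->
  mu.-integrable setT (EFin \o u) -> (forall t, u (- t) = - u t) ->
  \int[mu]_t u t = 0.
Proof.
move=> mu_ iu odd_u; have := Rintegral_arcN mu_.
under eq_Rintegral do rewrite odd_u -mulN1r.
rewrite RintegralZl // => h; lra.
Qed.

(** The sine part vanishes by oddness, the cosine part because its primitive is
    zero at both ends. *)
Lemma cintegral_zvarz (k : int) : k != 0 -> cintegral (fun t : R => zvar t ^ k) = 0.
Proof.
have pos (m : nat) : (0 < m)%N -> cintegral (fun t : R => zvar t ^ m%:Z) = 0.
  move=> m0; under eq_fun do rewrite zvar_expz.
  have ms : measurable_fun [set: T] (fun t : R => sin (m%:R * t)).
    apply: measurableT_comp; first exact: measurable_sinT.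
    exact: measurable_funM.
  apply: eq_ReIm; first exact: Rintegral_cosM.
  apply: Rintegral_odd => //= [|t]; last by rewrite mulrN sinN.
  apply: (@integrable_le _ _ (fun=> 1)) => // [t|]; first exact: sin_max.
  by apply: finite_measure_integrable_cst.
case: k => [[//|m] _|m _]; first exact: pos.
rewrite NegzE; under eq_fun do rewrite -zvarzJ.
rewrite cintegralJ ?pos ?rmorph0 //.
by have := cL1_mul (Lp2_zvarz R m.+1) (Lp2_cst (1 : C));
  under eq_fun do rewrite mulr1.
Qed.

Lemma cintegral_cst (c : C) : cintegral (fun _ : R => c) = c.
Proof. by apply: eq_ReIm => /=; rewrite Rintegral_arc_cst. Qed.

(** ** Essentially bounded functions *)

Lemma LpooP (f : R -> C) : Lp +oo%E f <->
  cmeasurable f /\ exists M : R, {ae mu, forall t, sqn (f t) <= M}.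
Proof.
have muT : (0 < mu [set: T])%E.
  by have -> : mu [set: T] = 1%E by exact: probability_setT.
split=> -[mf].
  rewrite /cnorm unlock muT => h; split => //.
  have := ess_sup_inf.ess_sup_ge mu (abse \o (fun t => (Normc.normc (f t))%:E)).
  move: (ess_sup_inf.ess_sup _ _) h => [y| |] // _ h.
    exists (y ^+ 2); apply: aeS h => t /=; rewrite lee_fin => h.
    rewrite sqn_normc -(real_normK (num_real (Normc.normc (f t)))).
    by rewrite lerXn2r ?nnegrE // (le_trans _ h).
  by exists 0; apply: aeS h => t /=; rewrite leeNy_eq.
move=> [M fM]; split => //; rewrite /cnorm unlock muT.
apply: (@le_lt_trans _ _ (M + 1)%:E); last exact: ltry.
apply/ess_sup_inf.ess_supP; apply: aeS fM => t /=; rewrite sqn_normc lee_fin => h.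
rewrite -[leLHS]mul1r; move: (Normc.normc (f t)) h => r h.
have := sqr_ge0 (r - 1); have := sqr_ge0 (r + 1).
by case: (lerP 0 r) => r0; [rewrite ger0_norm //|rewrite ltr0_norm //]; nra.
Qed.

Lemma LpooD (f g : R -> C) : Lp +oo%E f -> Lp +oo%E g ->
  Lp +oo%E (fun t => f t + g t).
Proof.
move=> /LpooP[mf [M fM]] /LpooP[mg [N gN]]; apply/LpooP.
split; first exact: cmeasurableD.
exists (2 * M + 2 * N); apply: aeS2 fM gN => t; rewrite /sqn !ReImE => h1 h2.
have := sqr_ge0 (complex.Re (f t) - complex.Re (g t)).
have := sqr_ge0 (complex.Im (f t) - complex.Im (g t)); lra.
Qed.

Lemma LpooZ (c : C) (f : R -> C) : Lp +oo%E f -> Lp +oo%E (fun t => c * f t).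
Proof.
move=> /LpooP[mf [M fM]]; apply/LpooP; split.
  by apply: cmeasurableM => //; exact: cmeasurable_cst.
by exists (sqn c * M); apply: aeS fM => t h; rewrite sqnM ler_wpM2l ?sqn_ge0.
Qed.

Lemma Lpoo_sum (I : Type) (s : seq I) (F : I -> R -> C) :
  (forall i, Lp +oo%E (F i)) -> Lp +oo%E (fun t => \sum_(i <- s) F i t).
Proof.
move=> h; elim: s => [|i s IH].
  under eq_fun do rewrite big_nil; apply/LpooP; split.
    exact: cmeasurable_cst.
  by exists (sqn (0 : C)); exact: aeW.
by under eq_fun do rewrite big_cons; exact: LpooD.
Qed.

Lemma LpooJ (f : R -> C) : Lp +oo%E f -> Lp +oo%E (fun t => (f t)^*).
Proof.
move=> /LpooP[mf [M fM]]; apply/LpooP; split; first exact: cmeasurableJ.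
by exists M; apply: aeS fM => t; rewrite sqnJ.
Qed.

Lemma Lp2_Lpoo_mul (f g : R -> C) : Lp +oo%E g -> Lp 2%:E f ->
  Lp 2%:E (fun t => g t * f t).
Proof. by move=> /LpooP[mg [M gM]]; exact: Lp2_bounded_mul gM. Qed.

Lemma Lpoo_Lp2 (f : R -> C) : Lp +oo%E f -> Lp 2%:E f.
Proof.
move=> lf; have := Lp2_Lpoo_mul lf (Lp2_cst 1).
by under eq_fun do rewrite mulr1.
Qed.

End Reflection.
(** * The scalar Hardy space and its orthogonal complement *)

Section ScalarHardy.
Context (R : realType).
Local Notation C := (R[i]).
Local Notation mu := (Defs.arc R).
Local Notation L2 := (@Lp R 2%:E).
Local Notation H2 := (@Hp R 2%:E).
Implicit Types (f g h : R -> C) (k : int).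

Lemma fourierE f k : fourier f k = dot f (fun t => zvar t ^ k).
Proof.
by rewrite /fourier /dot; congr cintegral; apply/funext => t; rewrite zvarzJ.
Qed.

Lemma fourier_zvarzM (m k : int) f :
  fourier (fun t => zvar t ^ m * f t) k = fourier f (k - m).
Proof.
congr cintegral; apply/funext => t.
by rewrite opprB addrC expfzDr ?zvar_neq0 //; ring.
Qed.

Lemma fourier_zvarM f k : fourier (fun t => zvar t * f t) k = fourier f (k - 1).
Proof. by rewrite -fourier_zvarzM; congr fourier; apply/funext => t. Qed.

Lemma fourier_cst (c : C) k : fourier (fun _ : R => c) k = if k == 0 then c else 0.
Proof.
rewrite /fourier; have [->|k0] := eqVneq k 0.
  by under eq_fun do rewrite oppr0 expr0z mulr1; exact: cintegral_cst.
rewrite cintegralZ ?cintegral_zvarz ?mulr0 ?oppr_eq0 //.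
by have := cL1_mul (Lp2_zvarz R (- k)) (Lp2_cst (1 : C));
  under eq_fun do rewrite mulr1.
Qed.

Lemma fourierD f g k : L2 f -> L2 g ->
  fourier (fun t => f t + g t) k = fourier f k + fourier g k.
Proof. by move=> lf lg; rewrite !fourierE dotDl //; exact: Lp2_zvarz. Qed.

Lemma fourierZ (c : C) f k : L2 f -> fourier (fun t => c * f t) k = c * fourier f k.
Proof. by move=> lf; rewrite !fourierE dotZl //; exact: Lp2_zvarz. Qed.

Lemma fourierB f g k : L2 f -> L2 g ->
  fourier (fun t => f t - g t) k = fourier f k - fourier g k.
Proof. by move=> lf lg; rewrite !fourierE dotBl //; exact: Lp2_zvarz. Qed.

Lemma fourier_sum (I : Type) (s : seq I) (F : I -> R -> C) k :
  (forall i, L2 (F i)) ->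
  fourier (fun t => \sum_(i <- s) F i t) k = \sum_(i <- s) fourier (F i) k.
Proof.
move=> h; elim: s => [|i s IH].
  under eq_fun do rewrite big_nil; rewrite big_nil fourier_cst; by case: eqP.
under eq_fun do rewrite big_cons.
by rewrite fourierD ?IH ?big_cons //; exact: Lp2_sum.
Qed.

Lemma Hp2_Lp2 f : H2 f -> L2 f. Proof. by case. Qed.

Lemma Hp2D f g : H2 f -> H2 g -> H2 (fun t => f t + g t).
Proof.
move=> [lf hf] [lg hg]; split=> [|k k0]; first exact: Lp2D.
by rewrite fourierD // hf // hg // addr0.
Qed.

Lemma Hp2Z (c : C) f : H2 f -> H2 (fun t => c * f t).
Proof.
move=> [lf hf]; split=> [|k k0]; first exact: Lp2Z.
by rewrite fourierZ // hf // mulr0.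
Qed.

Lemma Hp2B f g : H2 f -> H2 g -> H2 (fun t => f t - g t).
Proof.
move=> [lf hf] [lg hg]; split=> [|k k0]; first exact: Lp2B.
by rewrite fourierB // hf // hg // subr0.
Qed.

Lemma Hp2_cst (c : C) : H2 (fun=> c).
Proof.
split=> [|k k0]; first exact: Lp2_cst.
by rewrite fourier_cst lt_eqF.
Qed.

Lemma Hp2_sum (I : Type) (s : seq I) (F : I -> R -> C) :
  (forall i, H2 (F i)) -> H2 (fun t => \sum_(i <- s) F i t).
Proof.
move=> h; elim: s => [|i s IH].
  by under eq_fun do rewrite big_nil; exact: Hp2_cst.
by under eq_fun do rewrite big_cons; exact: Hp2D.
Qed.

Lemma Hp2_zvarM f : H2 f -> H2 (fun t => zvar t * f t).
Proof.
move=> [lf hf]; split=> [|k k0].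
  by have := Lp2_zvarz_mul 1 lf.
by rewrite fourier_zvarM hf // ltrBlDr (lt_trans k0).
Qed.

Lemma Hp2_zvarX (n : nat) : H2 (fun t => zvar t ^+ n).
Proof.
elim: n => [|n IH]; first exact: Hp2_cst.
by under eq_fun do rewrite exprS; exact: Hp2_zvarM.
Qed.

Definition negative_powers : set (R -> C) :=
  [set a | exists2 k : int, k < 0 & a = fun t => zvar t ^ k].

Lemma Hp2_orth f : H2 f <-> orth negative_powers f.
Proof.
split=> -[lf h]; split => //.
  by move=> _ [k k0 ->]; rewrite -fourierE h.
by move=> k k0; rewrite fourierE h //; exists k.
Qed.

Lemma Riesz_projection f : L2 f ->
  exists2 g, H2 g & forall h, H2 h -> dot (fun t => f t - g t) h = 0.
Proof.
move=> lf; have [|g /Hp2_orth Hg og] := @orth_projection R negative_powers f _ lf.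
  by move=> _ [k _ ->]; exact: Lp2_zvarz.
by exists g => // h /Hp2_orth; exact: og.
Qed.

(** The functions f of H^2 with [phi * f] in H^2 form a closed subspace that
    contains the nonnegative powers of z.  The component of f orthogonal to this
    subspace has no nonzero Fourier coefficient, so it vanishes. *)
Lemma Hpoo_mul_Hp2 (phi f : R -> C) : Hp +oo%E phi -> H2 f ->
  H2 (fun t => phi t * f t).
Proof.
move=> [bphi hphi] [lf hf].
have lphi := Lp2_Lpoo_mul (LpooJ bphi).
(* g is orthogonal to the second family when phi g lies in H^2 *)
pose A : set (R -> C) := negative_powers `|`
  [set a | exists2 k : int, k < 0 & a = fun t => (phi t)^* * zvar t ^ k].
have lA : A `<=` L2.
  move=> _ [[k _ ->]|[k _ ->]]; first exact: Lp2_zvarz.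
  by apply: lphi; exact: Lp2_zvarz.
have dotA g k : dot g (fun t => (phi t)^* * zvar t ^ k) =
    fourier (fun t => phi t * g t) k.
  rewrite /dot /fourier; congr cintegral; apply/funext => t.
  by rewrite rmorphM /= zvarzJ conjCK; ring.
have [g [lg og] fg] := orth_projection lA lf.
have zA (n : nat) : orth A (fun t => zvar t ^ n%:Z).
  split=> [|a]; first exact: Lp2_zvarz.
  have Hz := Hp2_zvarX n.
  case=> -[k k0 ->]; first by rewrite -fourierE; case: Hz => _; apply.
  rewrite dotA; under eq_fun do rewrite mulrC.
  rewrite (fourier_zvarzM n%:Z) hphi // ltrBlDr (lt_le_trans k0) //.
have f0 : {ae mu, forall t, f t - g t = 0}.
  apply: fourier_uniqueness; first exact: Lp2B.
  case=> m; first by rewrite fourierE fg.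
  rewrite fourierB // hf // fourierE og ?subrr //; left; by exists (Negz m).
have lpf : L2 (fun t => phi t * f t) by exact: Lp2_Lpoo_mul.
split=> // k k0.
have -> : fourier (fun t => phi t * f t) k = fourier (fun t => phi t * g t) k.
  rewrite !fourierE; apply: ae_eq_dot => //.
  - exact: Lp2_cmeasurable.
  - by apply: Lp2_cmeasurable; exact: Lp2_Lpoo_mul.
  - exact: cmeasurable_zvarz.
  - exact: cmeasurable_zvarz.
  - by apply: aeS f0 => t /eqP; rewrite subr_eq0 => /eqP ->.
  - exact: aeW.
by rewrite -dotA og //; right; exists k.
Qed.

(** ** The orthogonal complement of H^2 *)

Definition H2p f : Prop := L2 f /\ forall h, H2 h -> dot f h = 0.

Lemma H2pD f g : H2p f -> H2p g -> H2p (fun t => f t + g t).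
Proof.
move=> [lf hf] [lg hg]; split=> [|h Hh]; first exact: Lp2D.
by rewrite dotDl ?hf ?hg ?addr0 //; case: Hh.
Qed.

Lemma H2pZ (c : C) f : H2p f -> H2p (fun t => c * f t).
Proof.
move=> [lf hf]; split=> [|h Hh]; first exact: Lp2Z.
by rewrite dotZl ?hf ?mulr0 //; case: Hh.
Qed.

Lemma H2p_sum (I : Type) (s : seq I) (F : I -> R -> C) :
  (forall i, H2p (F i)) -> H2p (fun t => \sum_(i <- s) F i t).
Proof.
move=> h; elim: s => [|i s IH].
  under eq_fun do rewrite big_nil; split=> [|f Hf]; first exact: Lp2_cst.
  by rewrite /dot; under eq_fun do rewrite mul0r; exact: cintegral0.
by under eq_fun do rewrite big_cons; exact: H2pD.
Qed.

(** The decomposition along H^2 and its complement is unique in L^2, which is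
    all that inner products can see. *)
Lemma H2p_unique u f g x : H2p f -> H2p g -> H2 (fun t => u t - f t) ->
  H2 (fun t => u t - g t) -> L2 x -> dot f x = dot g x.
Proof.
move=> [lf hf] [lg hg] Hf Hg lx.
have Hd : H2 (fun t => f t - g t).
  have := Hp2B Hg Hf; congr Hp; apply/funext => t; ring.
have d0 : {ae mu, forall t, f t - g t = 0}.
  apply: normsq_eq0; first exact: Lp2B.
  by apply: (@complexI R); rewrite -dot_normsq dotBl ?hf ?hg ?subrr //; exact: Lp2B.
apply: ae_eq_dot; do 1?exact: Lp2_cmeasurable.
  by apply: aeS d0 => t /eqP; rewrite subr_eq0 => /eqP.
exact: aeW.
Qed.

Lemma dot_zvarM f g : dot (fun t => zvar t * f t) (fun t => zvar t * g t) = dot f g.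
Proof.
congr cintegral; apply/funext => t.
by rewrite rmorphM /= mulrACA -sqnE sqn_zvar mul1r.
Qed.

Lemma dot_cstr f (c : C) : L2 f -> dot f (fun=> c) = c^* * fourier f 0.
Proof.
move=> lf; rewrite fourierE -dotZr //; last exact: Lp2_zvarz.
by congr dot; apply/funext => t; rewrite expr0z mulr1.
Qed.

(** Multiplication by z followed by the projection onto the complement of H^2
    only removes the coefficient of z^(-1). *)
Lemma H2p_shift f : H2p f -> H2p (fun t => zvar t * f t - fourier f (-1)).
Proof.
move=> /[dup] Hf [lf hf].
have lzf : L2 (fun t => zvar t * f t) by have := Lp2_zvarz_mul 1 lf.
split=> [|h /[dup] Hh [lh hh]]; first by apply: Lp2B => //; exact: Lp2_cst.
(* h = z h1 + c with h1 in H^2 *)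
pose c := fourier h 0; pose h1 t := zvar t ^ (-1) * (h t - c).
have lhc : L2 (fun t => h t - c) by apply: Lp2B => //; exact: Lp2_cst.
have Hh1 : H2 h1.
  split=> [|k k0]; first exact: Lp2_zvarz_mul.
  rewrite fourier_zvarzM opprK fourierB //; last exact: Lp2_cst.
  rewrite fourier_cst; have [k1|k1] := eqVneq (k + 1) 0.
    by rewrite k1 -/c subrr.
  by rewrite hh ?subr0 // lt_neqAle k1 /= -ltzD1 ltrD2r.
have lh1 : L2 h1 by case: Hh1.
have hE : h = (fun t => zvar t * h1 t + c).
  apply/funext => t; rewrite /h1 mulrA -{1}(expr1z (zvar t)) -expfzDr ?zvar_neq0 //.
  by rewrite subrr expr0z mul1r subrK.
have lzh1 : L2 (fun t => zvar t * h1 t) by have := Lp2_zvarz_mul 1 lh1.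
rewrite dotBl //; last exact: Lp2_cst.
rewrite [X in dot _ X - _]hE dotDr //; last exact: Lp2_cst.
rewrite dot_zvarM hf // add0r dot_cstr // fourier_zvarM.
rewrite (dotC lh (Lp2_cst _)) dot_cstr // rmorphM /= conjCK -/c sub0r.
by rewrite mulrC subrr.
Qed.

Lemma dot_shift f g : H2p f -> H2p g ->
  dot (fun t => zvar t * f t - fourier f (-1)) (fun t => zvar t * g t - fourier g (-1))
  = dot f g - fourier f (-1) * (fourier g (-1))^*.
Proof.
move=> [lf hf] [lg hg].
have lzf : L2 (fun t => zvar t * f t) by have := Lp2_zvarz_mul 1 lf.
have lzg : L2 (fun t => zvar t * g t) by have := Lp2_zvarz_mul 1 lg.
have lc (c : C) : L2 (fun=> c) := Lp2_cst c.
rewrite dotBl ?dotBr //; do ?exact: Lp2B.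
rewrite dot_zvarM dot_cstr // (dotC lzg (lc _)) !dot_cstr //.
rewrite !fourier_zvarM !fourier_cst eqxx rmorphM /= conjCK sub0r; ring.
Qed.

End ScalarHardy.
(** * Hankel operators *)

Section VectorHardy.
Context (R : realType) (n : nat).
Local Notation C := (R[i]).
Local Notation mu := (Defs.arc R).
Local Notation vfun := (R -> 'cV[C]_n).
Local Notation mfun := (R -> 'M[C]_n).
Local Notation inner := (@Defs.inner R n).
Implicit Types (f g h : vfun) (Phi Psi : mfun).

Lemma innerE f g : L2_vec f -> L2_vec g ->
  inner f g = \sum_i dot (fun t => f t i 0) (fun t => g t i 0).
Proof. by move=> lf lg; apply: cintegral_sum => i; exact: cL1_dot. Qed.

Lemma entryB f g i :
  (fun t => (f t - g t) i 0) = (fun t => f t i 0 - g t i 0).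
Proof. by apply/funext => t; rewrite !mxE. Qed.

Lemma H2_vec_L2 f : H2_vec f -> L2_vec f.
Proof. by move=> Hf i; case: (Hf i). Qed.

Lemma H2_perpP g : H2_perp g <-> forall i, H2p (fun t => g t i 0).
Proof.
split=> [[lg og] i|Hg].
  split=> [|h Hh]; first exact: lg.
  pose hv : vfun := fun t => \col_j (if j == i then h t else 0).
  have hvE j : (fun t => hv t j 0) = if j == i then h else fun=> 0.
    by apply/funext => t; rewrite mxE; case: eqP.
  have Hv : H2_vec hv by move=> j; rewrite hvE; case: eqP => // _; exact: Hp2_cst.
  have := og _ Hv; rewrite innerE //; last exact: H2_vec_L2.
  rewrite (bigD1 i) //= hvE eqxx big1 ?addr0 // => j ji.
  rewrite hvE (negbTE ji) /dot; under eq_fun do rewrite rmorph0 mulr0.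
  exact: cintegral0.
split=> [i|h Hh]; first by case: (Hg i).
rewrite innerE ?big1 // => [i _|i|]; last exact: H2_vec_L2.
- by case: (Hg i) => _; exact.
- by case: (Hg i).
Qed.

Lemma Pperp_spec f : L2_vec f ->
  H2_perp (Pperp f) /\ H2_vec (fun t => f t - Pperp f t).
Proof.
move=> lf.
apply: (@xgetPex _ (fun=> 0) [set g | H2_perp g /\ H2_vec (fun t => f t - g t)]).
have /choice[p pP] : forall i : 'I_n, exists p : R -> C, Hp 2%:E p /\
    forall h : R -> C, Hp 2%:E h -> dot (fun t => f t i 0 - p t) h = 0.
  by move=> i; have [p Hp op] := Riesz_projection (lf i); exists p.
exists (fun t => \col_i (f t i 0 - p i t)); split.
  apply/H2_perpP => i; case: (pP i) => -[lp _] op.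
  by under eq_fun do rewrite mxE; split=> //; apply: Lp2B.
move=> i; under eq_fun do rewrite !mxE subKr.
by case: (pP i).
Qed.

Lemma Pperp_dot f g i (x : R -> C) : L2_vec f -> H2_perp g ->
  H2_vec (fun t => f t - g t) -> Lp 2%:E x ->
  dot (fun t => Pperp f t i 0) x = dot (fun t => g t i 0) x.
Proof.
move=> lf /H2_perpP Hg Hfg lx; have [/H2_perpP Pp Hfp] := Pperp_spec lf.
apply: (H2p_unique (Pp i) (Hg i) _ _ lx (u := fun t => f t i 0)).
- by rewrite -entryB; exact: Hfp.
- by rewrite -entryB; exact: Hfg.
Qed.

(** [Pperp] picks a representative that is known only up to null sets; in inner
    products any decomposition along H^2 and its complement can replace it. *)
Lemma Pperp_inner f f' g g' : L2_vec f -> L2_vec f' -> H2_perp g -> H2_perp g' ->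
  H2_vec (fun t => f t - g t) -> H2_vec (fun t => f' t - g' t) ->
  inner (Pperp f) (Pperp f') = inner g g'.
Proof.
move=> lf lf' Hg Hg' fg fg'.
have L (h : vfun) : H2_perp h -> L2_vec h by case.
have [Pp _] := Pperp_spec lf; have [Pp' _] := Pperp_spec lf'.
rewrite !innerE; do ?exact: L; apply: eq_bigr => i _.
rewrite (Pperp_dot i lf Hg fg); last exact: L.
rewrite (dotC (L _ Pp' i) (L _ Hg i)) (Pperp_dot i lf' Hg' fg'); last exact: L.
by rewrite -dotC; [|exact: L..].
Qed.

Lemma Jop_inner f g : L2_vec f -> L2_vec g -> inner (Jop f) (Jop g) = inner f g.
Proof.
move=> lf lg; rewrite /inner.
have -> : (fun t => \sum_i Jop f t i 0 * (Jop g t i 0)^*) =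
    (fun t => (fun s => \sum_i f s i 0 * (g s i 0)^*) (- t)).
  apply/funext => t; apply: eq_bigr => i _.
  rewrite /Jop !mxE rmorphM /= mulrACA conjCK [_^* * _]mulrC -sqnE sqn_zvar.
  by rewrite mul1r.
apply: cintegral_opp; apply: cL1_cmeasurable; apply: cL1_sum => i.
exact: cL1_dot.
Qed.

Lemma L2_mulmx Phi f : Linf_mx Phi -> L2_vec f -> L2_vec (fun t => Phi t *m f t).
Proof.
move=> lP lf i; under eq_fun do rewrite mxE.
by apply: Lp2_sum => j; exact: Lp2_Lpoo_mul.
Qed.

Lemma H2_mulmx Phi f : Hinf_mx Phi -> H2_vec f -> H2_vec (fun t => Phi t *m f t).
Proof.
move=> lP lf i; under eq_fun do rewrite mxE.
by apply: Hp2_sum => j; exact: Hpoo_mul_Hp2.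
Qed.

Lemma perp_inner_l u g g' : L2_vec u -> L2_vec g' -> H2_perp g ->
  H2_vec (fun t => u t - g' t) -> inner g' g = inner u g.
Proof.
move=> lu lg' /[dup] [[lg _]] /H2_perpP Hg Hu.
rewrite (innerE lg' lg) (innerE lu lg); apply: eq_bigr => i _.
have Hi : Hp 2%:E (fun t => u t i 0 - g' t i 0) by rewrite -entryB; exact: Hu.
have := (Hg i).2 _ Hi; rewrite (dotC (Hp2_Lp2 Hi) (lg i)).
rewrite (dotBl (lu i) (lg' i) (lg i)) => /eqP.
by rewrite conjC_eq0 subr_eq0 => /eqP.
Qed.

Lemma perp_inner_r a p f : L2_vec a -> H2_perp p -> H2_vec f ->
  inner f (fun t => a t - p t) = inner f a.
Proof.
move=> la /[dup] [[lp _]] /H2_perpP Hpp Hf; have lf := H2_vec_L2 Hf.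
have lap : L2_vec (fun t => a t - p t) by move=> i; rewrite entryB; exact: Lp2B.
rewrite (innerE lf lap) (innerE lf la); apply: eq_bigr => i _.
rewrite entryB (dotBr (la i) (lp i) (lf i)) (dotC (lp i) (lf i)).
by rewrite ((Hpp i).2 _ (Hf i)) conjC0 subr0.
Qed.

Lemma ae_refl (u v : vfun) : u = v -> {ae mu, forall t, u t = v t}.
Proof. by move=> ->; exact: aeW. Qed.

Lemma ae_entry (u v : vfun) i : {ae mu, forall t, u t = v t} ->
  {ae mu, forall t, u t i 0 = v t i 0}.
Proof. by apply: aeS => t ->. Qed.

(** Since J is an isometry, inner products of values of Hankel operators are
    inner products of projections. *)
Lemma hankel_inner Phi Psi f g : Linf_mx Phi -> Linf_mx Psi ->
  H2_vec f -> H2_vec g ->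
  inner (hankel Phi f) (hankel Psi g) =
  inner (Pperp (fun t => Phi t *m f t)) (Pperp (fun t => Psi t *m g t)).
Proof.
move=> lP lQ /H2_vec_L2 Hf /H2_vec_L2 Hg; apply: Jop_inner.
  by case: (Pperp_spec (L2_mulmx lP Hf)) => -[].
by case: (Pperp_spec (L2_mulmx lQ Hg)) => -[].
Qed.

(** The adjoint of the Hankel operator maps J g to the analytic part of the
    conjugate transpose of Phi applied to g. *)
Lemma hankel_adjoint Phi f : Linf_mx Phi -> H2_vec f ->
  let h := adjoint (hankel Phi) (hankel Phi f) in
  H2_vec h /\ forall f', H2_vec f' ->
    inner (hankel Phi f') (hankel Phi f) = inner f' h.
Proof.
move=> lP Hf; apply: (@xgetPex _ (fun=> 0) [set h | H2_vec h /\
  forall f', H2_vec f' -> inner (hankel Phi f') (hankel Phi f) = inner f' h]).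
have lPf := L2_mulmx lP (H2_vec_L2 Hf); have [Hg _] := Pperp_spec lPf.
have lg : L2_vec (Pperp (fun t => Phi t *m f t)) by case: Hg.
pose a : vfun := fun t =>
  (map_mx Num.conj (Phi t))^T *m Pperp (fun t => Phi t *m f t) t.
have la : L2_vec a.
  apply: L2_mulmx => // i j; under eq_fun do rewrite !mxE.
  exact: LpooJ.
have [Ha Hfa] := Pperp_spec la.
exists (fun t => a t - Pperp a t); split=> // f' Hf'.
have lPf' := L2_mulmx lP (H2_vec_L2 Hf'); have [[lg' _] Hfg'] := Pperp_spec lPf'.
rewrite [LHS](hankel_inner lP lP Hf' Hf) [LHS](perp_inner_l lPf' lg' Hg Hfg').
rewrite [RHS](perp_inner_r la Ha Hf').
congr cintegral; apply/funext => t.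
under eq_bigr do rewrite mxE mulr_suml.
rewrite exchange_big /=; apply: eq_bigr => k _.
rewrite mxE rmorph_sum mulr_sumr; apply: eq_bigr => i _.
by rewrite !mxE rmorphM /= conjCK; ring.
Qed.

Definition zmonomial j (m : nat) : vfun := fun t => zvar t ^+ m *: delta_mx j 0.

Lemma fourier_entry Phi i j (m : nat) :
  fourier (fun t => (Phi t *m zmonomial j m t) i 0) (-1) =
  fourier (fun t => Phi t i j) (-1 - m%:Z).
Proof.
rewrite -fourier_zvarzM; congr fourier; apply/funext => t.
rewrite -scalemxAr mxE; congr (_ * _); rewrite mxE (bigD1 j) //= big1 => [|k kj].
  by rewrite mxE !eqxx mulr1 addr0.
by rewrite mxE (negbTE kj) mulr0.
Qed.

Lemma H2_vec_zmonomial j (m : nat) : H2_vec (zmonomial j m).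
Proof.
by move=> i; under eq_fun do rewrite !mxE mulrC; apply: Hp2Z; exact: Hp2_zvarX.
Qed.

(** Replacing f and g by z f and z g removes from the inner product exactly the
    contribution of the first negative Fourier coefficients. *)
Lemma hankel_inner_shift Phi f g : Linf_mx Phi -> H2_vec f -> H2_vec g ->
  inner (hankel Phi (fun t => zvar t *: f t)) (hankel Phi (fun t => zvar t *: g t)) =
  inner (hankel Phi f) (hankel Phi g) -
  \sum_i fourier (fun t => (Phi t *m f t) i 0) (-1) *
         (fourier (fun t => (Phi t *m g t) i 0) (-1))^*.
Proof.
move=> lP Hf Hg.
have Hz h : H2_vec h -> H2_vec (fun t => zvar t *: h t).
  by move=> Hh i; under eq_fun do rewrite mxE; exact: Hp2_zvarM.
pose c h i := fourier (fun t => (Phi t *m h t) i 0) (-1).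
pose S h : vfun := fun t => zvar t *: Pperp (fun s => Phi s *m h s) t - \col_i c h i.
have cE h i : H2_vec h ->
    fourier (fun t => Pperp (fun s => Phi s *m h s) t i 0) (-1) = c h i.
  move=> Hh; have lPh := L2_mulmx lP (H2_vec_L2 Hh).
  have [Pp Hfp] := Pperp_spec lPh; have lp : L2_vec (Pperp (fun t => Phi t *m h t)) by case: Pp.
  have := Hfp i; rewrite entryB => -[_ /(_ (-1) isT)].
  rewrite (fourierB _ (lPh i) (lp i)).
  by move=> /eqP; rewrite subr_eq0 => /eqP.
have SE h i : H2_vec h -> (fun t => S h t i 0) = (fun t =>
    zvar t * Pperp (fun s => Phi s *m h s) t i 0 -
    fourier (fun t => Pperp (fun s => Phi s *m h s) t i 0) (-1)).
  by move=> Hh; rewrite cE //; apply/funext => t; rewrite !mxE.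
have perp h : H2_vec h -> H2_perp (Pperp (fun s => Phi s *m h s)).
  by move=> /H2_vec_L2 /(L2_mulmx lP) /Pperp_spec [].
have HS h : H2_vec h -> H2_perp (S h) /\
    H2_vec (fun t => Phi t *m (zvar t *: h t) - S h t).
  move=> Hh; have [/H2_perpP Pp Hfp] := Pperp_spec (L2_mulmx lP (H2_vec_L2 Hh)).
  split; first by apply/H2_perpP => i; rewrite SE //; exact: H2p_shift.
  move=> i; have := Hp2D (Hp2_zvarM (Hfp i)) (Hp2_cst (c h i)).
  congr Hp; apply/funext => t; rewrite /S -scalemxAr !mxE; ring.
have [Sf Hzf] := HS _ Hf; have [Sg Hzg] := HS _ Hg.
have lz h : H2_vec h -> L2_vec (fun t => Phi t *m (zvar t *: h t)).
  by move=> Hh; apply: L2_mulmx => //; apply: H2_vec_L2; exact: Hz.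
have lS h : H2_perp h -> L2_vec h by case.
rewrite [LHS](hankel_inner lP lP (Hz _ Hf) (Hz _ Hg)).
rewrite [LHS](Pperp_inner (lz _ Hf) (lz _ Hg) Sf Sg Hzf Hzg).
rewrite [LHS](innerE (lS _ Sf) (lS _ Sg)) [in RHS](hankel_inner lP lP Hf Hg).
rewrite [in RHS](innerE (lS _ (perp _ Hf)) (lS _ (perp _ Hg))).
rewrite -sumrB; apply: eq_bigr => i _; rewrite (SE _ _ Hf) (SE _ _ Hg).
rewrite (dot_shift ((H2_perpP _).1 (perp _ Hf) i) ((H2_perpP _).1 (perp _ Hg) i)).
congr (_ - _ * _); first exact: cE.
by congr (_^*); exact: cE.
Qed.

(** The adjoint picks a representative from a set that depends only on the
    functional [h |-> inner (A h) f]. *)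
Lemma eq_adjoint (A B : vfun -> vfun) f g :
  (forall h, H2_vec h -> inner (A h) f = inner (B h) g) ->
  adjoint A f = adjoint B g.
Proof.
move=> AB; congr xget; apply/seteqP; split=> h [Hh fh]; split=> // f' Hf'.
  by rewrite -AB // fh.
by rewrite AB // fh.
Qed.

End VectorHardy.

Section Main.
Context (R : realType) (n : nat).
Local Notation C := (R[i]).
Local Notation mu := (Defs.arc R).
Local Notation vfun := (R -> 'cV[C]_n).
Local Notation mfun := (R -> 'M[C]_n).
Local Notation inner := (@Defs.inner R n).
Implicit Types (f g h : vfun) (Phi Psi : mfun).

Local Opaque hankel Pperp adjoint.

Lemma eq_hankel_inner Phi Psi : Linf_mx Phi -> Linf_mx Psi ->
  eq_op_H2 (adjoint (hankel Phi) \o hankel Phi)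
           (adjoint (hankel Psi) \o hankel Psi) ->
  forall f g, H2_vec f -> H2_vec g ->
  inner (hankel Phi f) (hankel Phi g) = inner (hankel Psi f) (hankel Psi g).
Proof.
move=> lP lQ PQ f g Hf Hg.
have [HP eP] := hankel_adjoint lP Hg; have [HQ eQ] := hankel_adjoint lQ Hg.
rewrite [LHS](eP _ Hf) [RHS](eQ _ Hf).
have lf := H2_vec_L2 Hf.
rewrite [LHS](innerE lf (H2_vec_L2 HP)) [RHS](innerE lf (H2_vec_L2 HQ)).
apply: eq_bigr => i _.
have mf := Lp2_cmeasurable (lf i).
apply: (ae_eq_dot mf mf (Lp2_cmeasurable (H2_vec_L2 HP i))
  (Lp2_cmeasurable (H2_vec_L2 HQ i))); first exact: aeW.
exact: ae_entry (PQ _ Hg).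
Qed.

(** Subtracting the identities for z f, z g from those for f, g leaves the Gram
    matrices of the first negative coefficients; monomials produce all the
    negative Fourier coefficients this way. *)
Lemma eq_hankel_fourier Phi Psi : Linf_mx Phi -> Linf_mx Psi ->
  (forall f g, H2_vec f -> H2_vec g ->
  inner (hankel Phi f) (hankel Phi g) = inner (hankel Psi f) (hankel Psi g)) ->
  exists2 U : 'M[C]_n, U \is unitarymx & forall (m : nat) i j,
    fourier (fun t => Phi t i j) (-1 - m%:Z) =
    \sum_k U i k * fourier (fun t => Psi t k j) (-1 - m%:Z).
Proof.
move=> lP lQ PQ.
pose row (F : mfun) (p : nat * 'I_n) : 'rV[C]_n :=
  \row_i fourier (fun t => F t i p.2) (-1 - p.1%:Z).
have gram p q : row Phi p *m (map_mx Num.conj (row Phi q)^T) =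
    row Psi p *m (map_mx Num.conj (row Psi q)^T).
  have Hz h : H2_vec h -> H2_vec (fun t => zvar t *: h t).
    by move=> Hh i; under eq_fun do rewrite mxE; exact: Hp2_zvarM.
  have Hzp := H2_vec_zmonomial R p.2 p.1; have Hzq := H2_vec_zmonomial R q.2 q.1.
  have cancel (a b c d r s : C) : a = b - r -> c = d - s -> b = d -> a = c -> r = s.
    by move=> -> -> -> /addrI /oppr_inj.
  have := cancel _ _ _ _ _ _ (hankel_inner_shift lP Hzp Hzq)
    (hankel_inner_shift lQ Hzp Hzq) (PQ _ _ Hzp Hzq) (PQ _ _ (Hz _ Hzp) (Hz _ Hzq)).
  move=> h.
  have entry (F : mfun) : \sum_i row F p 0 i * (map_mx Num.conj (row F q)^T) i 0 =
      \sum_i fourier (fun t => (F t *m zmonomial p.2 p.1 t) i 0) (-1) *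
      (fourier (fun t => (F t *m zmonomial q.2 q.1 t) i 0) (-1))^*.
    apply: eq_bigr => i _.
    by rewrite (fourier_entry F i p.2 p.1) (fourier_entry F i q.2 q.1) !mxE.
  apply/matrixP => a b; rewrite !ord1 [LHS]mxE [RHS]mxE.
  exact: etrans (entry Phi) (etrans h (esym (entry Psi))).
have [V uV PV] := gram_family_unitary gram.
exists V^T; first by rewrite trmx_unitary.
move=> m i j; have /matrixP/(_ 0 i) := PV (m, j); rewrite !mxE => ->.
by apply: eq_bigr => k _; rewrite !mxE mulrC.
Qed.

Lemma Hinf_sub_mulmx Phi Psi (U : 'M[C]_n) : Linf_mx Phi -> Linf_mx Psi ->
  (forall (m : nat) i j, fourier (fun t => Phi t i j) (-1 - m%:Z) =
    \sum_k U i k * fourier (fun t => Psi t k j) (-1 - m%:Z)) ->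
  Hinf_mx (fun t => Phi t - U *m Psi t).
Proof.
move=> lP lQ PQ i j.
have E : (fun t => (Phi t - U *m Psi t) i j) =
    (fun t => Phi t i j + -1 * \sum_k U i k * Psi t k j).
  by apply/funext => t; rewrite !mxE mulN1r.
have lUQ k : Lp +oo%E (fun t => U i k * Psi t k j) by exact: LpooZ.
rewrite E; split.
  by apply: LpooD => //; apply: LpooZ; exact: Lpoo_sum.
case=> // m _; have -> : Negz m = -1 - m%:Z by rewrite NegzE -addn1 PoszD opprD addrC.
have l2 k : Lp 2%:E (fun t => U i k * Psi t k j) := Lpoo_Lp2 (lUQ k).
rewrite fourierD ?fourierZ ?fourier_sum ?PQ //; last 3 first.
- exact: Lp2_sum.
- exact: Lpoo_Lp2 (lP i j).
- by apply: Lp2Z; exact: Lp2_sum.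
under [X in _ + _ * X]eq_bigr do rewrite (fourierZ _ _ (Lpoo_Lp2 (lQ _ _))).
by rewrite mulN1r subrr.
Qed.

(** U times the part of Psi f orthogonal to H^2 is the part of Phi f orthogonal
    to H^2, and the inner product does not see U. *)
Lemma hankel_inner_unitary Phi Psi (U : 'M[C]_n) : Linf_mx Phi -> Linf_mx Psi ->
  U \is unitarymx -> Hinf_mx (fun t => Phi t - U *m Psi t) ->
  forall f g, H2_vec f -> H2_vec g ->
  inner (hankel Phi f) (hankel Phi g) = inner (hankel Psi f) (hankel Psi g).
Proof.
move=> lP lQ uU HU f g Hf Hg.
rewrite [LHS](hankel_inner lP lP Hf Hg) [RHS](hankel_inner lQ lQ Hf Hg).
pose w h : vfun := fun t => U *m Pperp (fun s => Psi s *m h s) t.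
have Hw h : H2_vec h -> H2_perp (w h) /\ H2_vec (fun t => Phi t *m h t - w h t).
  move=> Hh; have [/H2_perpP Pp Hfp] := Pperp_spec (L2_mulmx lQ (H2_vec_L2 Hh)).
  split.
    by apply/H2_perpP => i; under eq_fun do rewrite mxE; apply: H2p_sum => k; exact: H2pZ.
  move=> i.
  have : Hp 2%:E (fun t => ((Phi t - U *m Psi t) *m h t) i 0 + \sum_k U i k *
     (Psi t *m h t - Pperp (fun s => Psi s *m h s) t) k 0).
    by apply: Hp2D; [exact: H2_mulmx|apply: Hp2_sum => k; exact: Hp2Z].
  congr Hp; apply/funext => t.
  transitivity (((Phi t - U *m Psi t) *m h t +
    U *m (Psi t *m h t - Pperp (fun s => Psi s *m h s) t)) i 0).
    by rewrite mxE [in RHS]mxE; congr (_ + _); rewrite mxE.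
  by rewrite mulmxBl mulmxBr mulmxA addrA subrK.
have [wf fw] := Hw _ Hf; have [wg gw] := Hw _ Hg.
rewrite [LHS](Pperp_inner (L2_mulmx lP (H2_vec_L2 Hf)) (L2_mulmx lP (H2_vec_L2 Hg))
  wf wg fw gw).
congr cintegral; apply/funext => t.
have dotE (x y : 'cV[C]_n) : \sum_i x i 0 * (y i 0)^* =
    (x^T *m map_mx Num.conj y) 0 0.
  by rewrite mxE; apply: eq_bigr => i _; rewrite !mxE.
rewrite !dotE /w trmx_mul map_mxM mulmxA -(mulmxA _ U^T).
have -> : U^T *m map_mx Num.conj U = 1%:M.
  have : U^T \is unitarymx by rewrite trmx_unitary.
  by move=> /unitarymxP; rewrite trmxK.
by rewrite mulmx1.
Qed.

End Main.

Theorem theorem5p5 (R : realType) (n : nat) (Phi Psi : R -> 'M[R[i]]_n)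
    (LPhi : Linf_mx Phi) (LPsi : Linf_mx Psi)
    (bPhi : bounded_type_mx Phi) (bPsi : bounded_type_mx Psi)
    (tss : tensored_scalar_singularity Phi \/ tensored_scalar_singularity Psi) :
  eq_op_H2 (adjoint (hankel Phi) \o hankel Phi)
           (adjoint (hankel Psi) \o hankel Psi) <->
  exists2 U : 'M[R[i]]_n, U \is unitarymx &
    Hinf_mx (fun t => Phi t - U *m Psi t).
Proof.
split=> [/(eq_hankel_inner LPhi LPsi)/(eq_hankel_fourier LPhi LPsi)|].
  by move=> [U uU PQ]; exists U => //; exact: Hinf_sub_mulmx.
move=> [U uU HU] f Hf.
suff E : adjoint (hankel Phi) (hankel Phi f) = adjoint (hankel Psi) (hankel Psi f).
  exact: ae_refl E.
apply: eq_adjoint => h Hh.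
exact: (hankel_inner_unitary LPhi LPsi uU HU Hh Hf).
Qed.
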